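(* Let $k$ be an algebraically closed field of characteristic zero. Let $G$ be a finite group of odd order such that $\mathrm{Int}_k(G)=\mathrm{Inn}(G)$. If $G$ has a unique maximal abelian normal subgroup $A$, then there is a group isomorphism $$\mathrm{H}^2_\ell(G)\cong H^2(\widehat A,k^\times)^G .$$
   Context: $k[G]$ is the group algebra with coproduct $\Delta(g)=g\otimes g$ for $g\in G$. A twist on $k[G]$ is an invertible element $F\in k[G]\otimes k[G]$ with $(F\otimes 1)(\Delta\otimes\mathrm{id})(F)=(1\otimes F)(\mathrm{id}\otimes\Delta)(F)$. It is invariant if $\Delta(a)F=F\Delta(a)$ for all $a\in k[G]$. Invariant twists form a group $Z^2$ under multiplication. For $a$ in the group $A^1$ of invertible central elements of $k[G]$ put $\delta^1(a)=(a\otimes a)\Delta(a^{-1})$; $\delta^1$ is a homomorphism onto a central subgroup of $Z^2$, and $\mathrm{H}^2_\ell(G)=Z^2/\delta^1(A^1)$. $\mathrm{Int}_k(G)$ is the group of automorphisms of $G$ of the form $g\mapsto aga^{-1}$ with $a$ in the normalizer of $G$ in $k[G]^\times$; $\mathrm{Inn}(G)\subset\mathrm{Int}_k(G)$ is the group of inner automorphisms. $\widehat A=\mathrm{Hom}(A,k^\times)$ is the character group of $A$; $H^2(\widehat A,k^\times)$ is group cohomology with trivial action on $k^\times$, and the superscript $G$ denotes invariants under the action of $G$ induced by conjugation on $A$. ''Unique maximal abelian normal subgroup'' means unique maximal element, for inclusion, among the abelian normal subgroups of $G$ (so it contains all of them). *)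

(* Defs.v *)
From HB Require Import structures.
From mathcomp Require Import all_boot all_order all_algebra all_fingroup.
From mathcomp Require Import all_field generic_quotient.
From mathcomp Require Import ring.
From mathcomp Require Import boolp.

Set Implicit Arguments.
Unset Strict Implicit.
Unset Printing Implicit Defensive.

Import GRing.Theory.
Local Open Scope ring_scope.
Local Open Scope quotient_scope.

Section Units.
Variable R : unitRingType.

Record units := Units { uval : R; units_valP : uval \is a GRing.unit }.
HB.instance Definition _ := [isSub for uval].
HB.instance Definition _ := [Choice of units by <:].

Implicit Types x y z : units.

Definition units_one : units := Units (unitr1 R).
Fact units_mul_subproof x y : uval x * uval y \is a GRing.unit.
Proof. by apply: GRing.rpredM; exact: units_valP. Qed.
Definition units_mul x y : units := Units (units_mul_subproof x y).
Fact units_inv_subproof x : (uval x)^-1 \is a GRing.unit.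
Proof. by rewrite unitrV; exact: units_valP. Qed.
Definition units_inv x : units := Units (units_inv_subproof x).

Fact units_mulA : associative units_mul.
Proof. by move=> x y z; apply: val_inj; exact: mulrA. Qed.
Fact units_mul1 : left_id units_one units_mul.
Proof. by move=> x; apply: val_inj; exact: mul1r. Qed.
Fact units_mulr1 : right_id units_one units_mul.
Proof. by move=> x; apply: val_inj; exact: mulr1. Qed.
Fact units_mulV : left_inverse units_one units_inv units_mul.
Proof. by move=> x; apply: val_inj; apply: mulVr; exact: units_valP. Qed.
Fact units_mulVr : right_inverse units_one units_inv units_mul.
Proof. by move=> x; apply: val_inj; apply: mulrV; exact: units_valP. Qed.

HB.instance Definition _ := isGroup.Build units
  units_mulA units_mul1 units_mulr1 units_mulV units_mulVr.

Lemma val_unitsM x y : uval (x * y)%g = uval x * uval y. Proof. by []. Qed.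
Lemma val_units1 : uval (1%g : units) = 1. Proof. by []. Qed.
Lemma val_unitsV x : uval (x^-1)%g = (uval x)^-1. Proof. by []. Qed.
Lemma units_inj : injective uval. Proof. exact: val_inj. Qed.

End Units.

Lemma unitsC (R : comUnitRingType) (x y : units R) : (x * y = y * x)%g.
Proof. by apply: units_inj; rewrite !val_unitsM mulrC. Qed.

Lemma uval_neq0 (F : fieldType) (x : units F) : uval x != 0.
Proof. by rewrite -unitfE units_valP. Qed.

Record normal_subgroup (T : groupType) := NormalSubgroup {
  ns_pred :> {pred T};
  ns_group : group_closed ns_pred;
  ns_norm : forall x y : T, x \in ns_pred -> (x ^ y)%g \in ns_pred }.

Section Quotient.
Variables (T : groupType) (N : normal_subgroup T).
Local Open Scope group_scope.

Definition ns_rel (x y : T) := x^-1 * y \in N.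

Fact ns1 : 1 \in N. Proof. by case: (ns_group N). Qed.
Fact nsV x : x \in N -> x^-1 \in N.
Proof. by move=> Nx; rewrite -(mul1g x^-1); case: (ns_group N) => N1; apply. Qed.
Fact nsM x y : x \in N -> y \in N -> x * y \in N.
Proof.
by move=> Nx Ny; rewrite -[y]invgK; case: (ns_group N) => _; apply=> //; apply: nsV.
Qed.

Fact ns_rel_equiv : equiv_class_of ns_rel.
Proof.
split; rewrite /ns_rel.
- by move=> x; rewrite mulVg ns1.
- suff H x y : x^-1 * y \in N -> y^-1 * x \in N by move=> x y; apply/idP/idP; apply: H.
  by move/nsV; rewrite invgM invgK.
- move=> y x z Nxy Nyz.
  by have := nsM Nxy Nyz; rewrite mulgA -(mulgA x^-1) mulgV mulg1.
Qed.

Canonical ns_equiv := EquivRelPack ns_rel_equiv.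

Definition quotg := {eq_quot ns_equiv}.
HB.instance Definition _ := Choice.on quotg.
HB.instance Definition _ := EqQuotient.on quotg.

Definition to_quotg (x : T) : quotg := \pi x.

Lemma to_quotgP x y : reflect (to_quotg x = to_quotg y) (x^-1 * y \in N).
Proof. by apply: (iffP idP) => [|/eqmodP//]; move=> ?; apply/eqmodP. Qed.

Lemma to_quotg_repr (u : quotg) : to_quotg (repr u) = u.
Proof. exact: reprK. Qed.

Definition quotg_mul (u v : quotg) : quotg := to_quotg (repr u * repr v).
Definition quotg_inv (u : quotg) : quotg := to_quotg (repr u)^-1.

Lemma quotg_mulE x y : quotg_mul (to_quotg x) (to_quotg y) = to_quotg (x * y).
Proof.
rewrite /quotg_mul; apply/to_quotgP.
have /to_quotgP Hx := to_quotg_repr (to_quotg x).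
have /to_quotgP Hy := to_quotg_repr (to_quotg y).
move: (repr (to_quotg x)) (repr (to_quotg y)) Hx Hy => x' y' Hx Hy.
have -> : (x' * y')^-1 * (x * y) = (x'^-1 * x) ^ y' * (y'^-1 * y).
  by rewrite conjgE invgM !mulgA mulgK.
by apply: nsM => //; apply: ns_norm.
Qed.

Lemma quotg_invE x : quotg_inv (to_quotg x) = to_quotg x^-1.
Proof.
rewrite /quotg_inv; apply/to_quotgP.
have /to_quotgP := to_quotg_repr (to_quotg x).
move: (repr _) => y Hy.
have -> : y^-1^-1 * x^-1 = ((y^-1 * x)^-1) ^ y^-1.
  by rewrite conjgE invgM !invgK !mulgA mulgK.
by apply: ns_norm; apply: nsV.
Qed.

Fact quotg_mulA : associative quotg_mul.
Proof.
move=> u v w; rewrite -(to_quotg_repr u) -(to_quotg_repr v) -(to_quotg_repr w).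
by rewrite !quotg_mulE mulgA.
Qed.
Fact quotg_mul1 : left_id (to_quotg 1) quotg_mul.
Proof. by move=> u; rewrite -(to_quotg_repr u) quotg_mulE mul1g. Qed.
Fact quotg_mulr1 : right_id (to_quotg 1) quotg_mul.
Proof. by move=> u; rewrite -(to_quotg_repr u) quotg_mulE mulg1. Qed.
Fact quotg_mulV : left_inverse (to_quotg 1) quotg_inv quotg_mul.
Proof. by move=> u; rewrite -(to_quotg_repr u) quotg_invE quotg_mulE mulVg. Qed.
Fact quotg_mulVr : right_inverse (to_quotg 1) quotg_inv quotg_mul.
Proof. by move=> u; rewrite -(to_quotg_repr u) quotg_invE quotg_mulE mulgV. Qed.

HB.instance Definition _ := isGroup.Build quotg
  quotg_mulA quotg_mul1 quotg_mulr1 quotg_mulV quotg_mulVr.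

Lemma to_quotgM x y : to_quotg (x * y) = to_quotg x * to_quotg y.
Proof. exact/esym/quotg_mulE. Qed.

End Quotient.

(* [galg k G] is k[G]: an element is its family of coefficients, and the
   product is convolution. *)
Definition galg (k : fieldType) (G : finGroupType) := {ffun G -> k^o}.

Section GroupAlgebra.
Variables (k : fieldType) (G : finGroupType).
Local Notation kG := (galg k G).
HB.instance Definition _ := Vector.copy kG {ffun G -> k^o}.
Implicit Types x y z : kG.

Definition gelt (g : G) : kG := [ffun h => (h == g)%:R : k].

Definition galg_mul x y : kG :=
  [ffun g => \sum_(h : G) (x h : k) * (y (h^-1 * g)%g : k) : k].

Lemma galg_sumE x : x = \sum_g (x g : k) *: gelt g.
Proof.
apply/ffunP=> h; rewrite sum_ffunE (bigD1 h) //= !ffunE eqxx.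
rewrite big1 ?addr0 => [|g /negPf ngh]; last first.
  by rewrite !ffunE eq_sym ngh; exact: mulr0.
by symmetry; exact: mulr1.
Qed.

Fact galg_mulDl : left_distributive galg_mul +%R.
Proof.
move=> x y z; apply/ffunP=> g; rewrite !ffunE -big_split /=.
by apply: eq_bigr => h _; rewrite !ffunE; exact: mulrDl.
Qed.
Fact galg_mulDr : right_distributive galg_mul +%R.
Proof.
move=> x y z; apply/ffunP=> g; rewrite !ffunE -big_split /=.
by apply: eq_bigr => h _; rewrite !ffunE; exact: mulrDr.
Qed.
Fact galg_mulZl (a : k) x y : galg_mul (a *: x) y = a *: galg_mul x y.
Proof.
apply/ffunP=> g; rewrite !ffunE /GRing.scale /= mulr_sumr.
by apply: eq_bigr => h _; rewrite !ffunE; rewrite /GRing.scale /= mulrA.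
Qed.
Fact galg_mulZr (a : k) x y : galg_mul x (a *: y) = a *: galg_mul x y.
Proof.
apply/ffunP=> g; rewrite !ffunE /GRing.scale /= mulr_sumr.
by apply: eq_bigr => h _; rewrite !ffunE; rewrite /GRing.scale /= mulrCA.
Qed.
Fact galg_mul0 x : galg_mul 0 x = 0.
Proof. by rewrite -(scale0r 0) galg_mulZl !scale0r. Qed.
Fact galg_mulr0 x : galg_mul x 0 = 0.
Proof. by rewrite -(scale0r 0) galg_mulZr !scale0r. Qed.

Fact galg_mulg g h : galg_mul (gelt g) (gelt h) = gelt (g * h)%g.
Proof.
apply/ffunP=> u; rewrite !ffunE (bigD1 g) //= !ffunE eqxx mul1r.
rewrite big1 ?addr0 => [|v /negPf nvg]; last by rewrite !ffunE nvg mul0r.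
by rewrite -(inj_eq (mulgI g)) mulKVg.
Qed.

Fact galg_mul_suml I (r : seq I) (F : I -> kG) y :
  galg_mul (\sum_(i <- r) F i) y = \sum_(i <- r) galg_mul (F i) y.
Proof.
elim: r => [|i r IH]; first by rewrite !big_nil galg_mul0.
by rewrite !big_cons galg_mulDl IH.
Qed.
Fact galg_mul_sumr I (r : seq I) (F : I -> kG) y :
  galg_mul y (\sum_(i <- r) F i) = \sum_(i <- r) galg_mul y (F i).
Proof.
elim: r => [|i r IH]; first by rewrite !big_nil galg_mulr0.
by rewrite !big_cons galg_mulDr IH.
Qed.

Fact galg_mulA : associative galg_mul.
Proof.
move=> x y z; rewrite (galg_sumE x) (galg_sumE y) (galg_sumE z).
rewrite !galg_mul_suml; apply: eq_bigr => g _.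
rewrite !galg_mulZl; congr (_ *: _); rewrite galg_mul_sumr.
rewrite [in RHS](galg_mul_sumr _ _ (gelt g)) galg_mul_suml; apply: eq_bigr => h _.
rewrite !(galg_mulZl, galg_mulZr); congr (_ *: _).
rewrite !galg_mul_sumr; apply: eq_bigr => u _.
by rewrite !galg_mulZr !galg_mulg mulgA.
Qed.
Fact galg_mul1 : left_id (gelt 1%g) galg_mul.
Proof.
move=> x; rewrite (galg_sumE x) galg_mul_sumr; apply: eq_bigr => g _.
by rewrite galg_mulZr galg_mulg mul1g.
Qed.
Fact galg_mulr1 : right_id (gelt 1%g) galg_mul.
Proof.
move=> x; rewrite (galg_sumE x) galg_mul_suml; apply: eq_bigr => g _.
by rewrite galg_mulZl galg_mulg mulg1.
Qed.
Fact galg_oner_neq0 : gelt 1%g != 0.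
Proof.
by apply/eqP=> /ffunP/(_ 1%g); rewrite !ffunE eqxx; apply/eqP; exact: oner_neq0.
Qed.

HB.instance Definition _ := GRing.Zmodule_isNzRing.Build kG
  galg_mulA galg_mul1 galg_mulr1 galg_mulDl galg_mulDr galg_oner_neq0.
Fact galg_scalerAl (a : k) x y : a *: (x * y) = (a *: x) * y.
Proof. exact/esym/galg_mulZl. Qed.
Fact galg_scalerAr (a : k) x y : a *: (x * y) = x * (a *: y).
Proof. exact/esym/galg_mulZr. Qed.
HB.instance Definition _ := GRing.Lmodule_isLalgebra.Build k kG galg_scalerAl.
HB.instance Definition _ := GRing.Lalgebra_isAlgebra.Build k kG galg_scalerAr.
HB.instance Definition _ := Algebra_isFalgebra.Build k kG.

Lemma geltM g h : gelt (g * h)%g = gelt g * gelt h.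
Proof. exact/esym/galg_mulg. Qed.
Lemma gelt1 : gelt 1%g = 1. Proof. by []. Qed.

Definition glin (V : lmodType k) (phi : G -> V) x : V := \sum_g (x g : k) *: phi g.

Fact glin_is_linear (V : lmodType k) (phi : G -> V) : linear (glin phi).
Proof.
move=> a x y; rewrite /glin scaler_sumr -big_split; apply: eq_bigr => g _ /=.
by rewrite !ffunE scalerDl scalerA.
Qed.
HB.instance Definition _ (V : lmodType k) (phi : G -> V) :=
  GRing.isLinear.Build k kG V _ (glin phi) (glin_is_linear phi).

Lemma glinE (V : lmodType k) (phi : G -> V) g : glin phi (gelt g) = phi g.
Proof.
rewrite /glin (bigD1 g) //= big1 ?addr0 => [|h /negPf nhg].
  by rewrite !ffunE eqxx scale1r.
by rewrite !ffunE nhg scale0r.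
Qed.

Lemma galg_linE (V : lmodType k) (f : {linear kG -> V}) x :
  f x = \sum_g (x g : k) *: f (gelt g).
Proof.
by rewrite {1}(galg_sumE x) linear_sum; apply: eq_bigr => g _; rewrite linearZ.
Qed.

Lemma glin_multiplicative (B : algType k) (phi : G -> B) :
  {morph phi : g h / (g * h)%g >-> g * h} ->
  {morph glin phi : x y / x * y}.
Proof.
move=> phiM x y; rewrite (galg_sumE x) mulr_suml !linear_sum mulr_suml.
apply: eq_bigr => g _; rewrite (galg_sumE y) mulr_sumr !linear_sum mulr_sumr.
apply: eq_bigr => h _.
by rewrite -!(galg_scalerAl, galg_scalerAr) -geltM !linearZ /= !glinE phiM
           -scalerAl -scalerAr.
Qed.

End GroupAlgebra.

Notation prodG G H := (Datatypes_prod__canonical__fingroup_FinGroup G H).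

(* k[G] (x) k[H] is represented by k[G x H], with g (x) h = (g, h); [galgA] is
   then the reassociation of threefold tensor products, and all of them are
   bracketed to the left below. *)
Section Tensor.
Variable k : fieldType.
Implicit Types G H K : finGroupType.

Definition tens G H (x : galg k G) (y : galg k H) : galg k (prodG G H) :=
  [ffun p => (x p.1 : k) * (y p.2 : k) : k].

Lemma tens_gelt G H (g : G) (h : H) :
  tens (gelt k g) (gelt k h) = gelt k ((g, h) : prodG G H).
Proof.
apply/ffunP=> -[u v]; rewrite !ffunE /= xpair_eqE.
by case: (u == g); case: (v == h); rewrite ?(mul0r, mulr0, mulr1).
Qed.

Lemma tens11 G H : tens (1 : galg k G) (1 : galg k H) = 1.
Proof. by rewrite -!gelt1 tens_gelt. Qed.

Lemma tens_sum G H (I J : finType) (a : I -> k) (b : J -> k) F E :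
  tens (\sum_i a i *: F i : galg k G) (\sum_j b j *: E j : galg k H) =
  \sum_i \sum_j (a i * b j) *: tens (F i) (E j).
Proof.
apply/ffunP=> p; rewrite ffunE !sum_ffunE big_distrlr /=.
apply: eq_bigr => i _; rewrite sum_ffunE; apply: eq_bigr => j _.
by rewrite !ffunE; exact: mulrACA.
Qed.

Lemma tensM G H (x x' : galg k G) (y y' : galg k H) :
  tens x y * tens x' y' = tens (x * x') (y * y').
Proof.
apply/ffunP=> -[g h]; rewrite !ffunE /= big_distrlr /= pair_bigA /=.
by apply: eq_bigr => -[u v] _; rewrite !ffunE /= mulrACA.
Qed.

Definition tens_map G G' H H' (f : galg k G -> galg k G')
    (f' : galg k H -> galg k H') :
    galg k (prodG G H) -> galg k (prodG G' H') :=
  glin (fun p : prodG G H => tens (f (gelt k p.1)) (f' (gelt k p.2))).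

HB.instance Definition _ G G' H H' (f : galg k G -> galg k G')
  (f' : galg k H -> galg k H') := GRing.Linear.on (tens_map f f').

Lemma tens_map_tens G G' H H' (f : {linear galg k G -> galg k G'})
    (f' : {linear galg k H -> galg k H'}) x y :
  tens_map f f' (tens x y) = tens (f x) (f' y).
Proof.
rewrite [in RHS](galg_linE f x) [in RHS](galg_linE f' y).
rewrite tens_sum pair_bigA; apply: eq_bigr => p _.
by rewrite !ffunE.
Qed.

Lemma tens_map_multiplicative G G' H H' (f : galg k G -> galg k G')
    (f' : galg k H -> galg k H') :
  {morph f : x y / x * y} -> {morph f' : x y / x * y} ->
  {morph tens_map f f' : x y / x * y}.
Proof.
move=> fM fM'; apply: glin_multiplicative => -[g h] [g' h'] /=.
by rewrite tensM -fM -fM' -!geltM.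
Qed.

Definition galgA G H K : galg k (prodG G (prodG H K)) -> galg k (prodG (prodG G H) K) :=
  glin (fun p : prodG G (prodG H K) =>
    gelt k ((p.1, p.2.1, p.2.2) : prodG (prodG G H) K)).
HB.instance Definition _ G H K := GRing.Linear.on (@galgA G H K).

Lemma galgA_tens G H K (x : galg k G) (y : galg k H) (z : galg k K) :
  galgA (tens x (tens y z)) = tens (tens x y) z.
Proof.
rewrite [in RHS](galg_sumE x) [in RHS](galg_sumE y) [in RHS](galg_sumE z).
rewrite tens_sum pair_bigA tens_sum pair_bigA /galgA /glin.
rewrite (reindex (fun p : prodG (prodG G H) K => (p.1.1, (p.1.2, p.2)))) /=; last first.
  by exists (fun p => (p.1, p.2.1, p.2.2)) => -[a b] //=; [case: a | case: b].
by apply: eq_bigr => -[[a b] c] _; rewrite !ffunE /= mulrA !tens_gelt.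
Qed.

Lemma galgA_multiplicative G H K : {morph @galgA G H K : x y / x * y}.
Proof. by apply: glin_multiplicative => p q; rewrite -geltM. Qed.

Lemma galgA1 G H K : @galgA G H K 1 = 1.
Proof. by rewrite -!gelt1 /galgA glinE. Qed.

End Tensor.

Section MorphUnit.
Variables (A B : unitRingType) (f : A -> B).
Hypotheses (f1 : f 1 = 1) (fM : {morph f : x y / x * y}).

Lemma morph_unit x : x \is a GRing.unit -> f x \is a GRing.unit.
Proof.
move=> ux; apply/unitrP; exists (f x^-1).
by rewrite -!fM mulVr // mulrV // f1.
Qed.

Lemma morph_unitV x : x \is a GRing.unit -> f x^-1 = (f x)^-1.
Proof.
move=> ux; apply: (mulrI (morph_unit ux)).
by rewrite -fM !mulrV ?morph_unit // f1.
Qed.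

End MorphUnit.

Section LazyCohomology.
Variables (k : fieldType) (G : finGroupType).
Local Notation kG := (galg k G).
Local Notation kG2 := (galg k (prodG G G)).
Local Notation kG3 := (galg k (prodG (prodG G G) G)).

Definition coprod : kG -> kG2 := glin (fun g => tens (gelt k g) (gelt k g)).
HB.instance Definition _ := GRing.Linear.on coprod.

Definition coprod_l (F : kG2) : kG3 := tens_map coprod idfun F.
Definition coprod_r (F : kG2) : kG3 := galgA (tens_map idfun coprod F).
Definition one_r (F : kG2) : kG3 := tens F (1 : kG).
Definition one_l (F : kG2) : kG3 := galgA (tens (1 : kG) F).

(* No counit normalization is imposed. *)
Definition is_twist (F : kG2) : Prop :=
  F \is a GRing.unit /\ one_r F * coprod_l F = one_l F * coprod_r F.

Definition is_invariant (F : kG2) : Prop :=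
  forall a : kG, coprod a * F = F * coprod a.

Fact coprod_l_is_linear : linear coprod_l.
Proof. by move=> a x y; rewrite /coprod_l linearP. Qed.
HB.instance Definition _ := GRing.isLinear.Build k kG2 kG3 _
  coprod_l coprod_l_is_linear.
Fact coprod_r_is_linear : linear coprod_r.
Proof. by move=> a x y; rewrite /coprod_r !linearP. Qed.
HB.instance Definition _ := GRing.isLinear.Build k kG2 kG3 _
  coprod_r coprod_r_is_linear.

Lemma coprodM : {morph coprod : x y / x * y}.
Proof. by apply: glin_multiplicative => g h; rewrite tensM -!geltM. Qed.
Lemma coprod1 : coprod 1 = 1.
Proof. by rewrite -gelt1 /coprod glinE !gelt1 tens11. Qed.
Lemma coprod_lM : {morph coprod_l : x y / x * y}.
Proof. by apply: tens_map_multiplicative; [exact: coprodM|]. Qed.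
Lemma coprod_l1 : coprod_l 1 = 1.
Proof. by rewrite /coprod_l -tens11 tens_map_tens /= coprod1 !tens11. Qed.
Lemma coprod_rM : {morph coprod_r : x y / x * y}.
Proof.
move=> x y; rewrite /coprod_r /= -galgA_multiplicative; congr galgA.
by apply: tens_map_multiplicative; [|exact: coprodM].
Qed.
Lemma coprod_r1 : coprod_r 1 = 1.
Proof.
by rewrite /coprod_r /= -tens11 tens_map_tens /= coprod1 tens11 galgA1.
Qed.
Lemma one_rM : {morph one_r : x y / x * y}.
Proof. by move=> x y; rewrite /one_r tensM mulr1. Qed.
Lemma one_r1 : one_r 1 = 1. Proof. exact: tens11. Qed.
Lemma one_lM : {morph one_l : x y / x * y}.
Proof. by move=> x y; rewrite /one_l -galgA_multiplicative tensM mulr1. Qed.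
Lemma one_l1 : one_l 1 = 1. Proof. by rewrite /one_l tens11 galgA1. Qed.

Lemma coprod_gelt g : coprod (gelt k g) = tens (gelt k g) (gelt k g).
Proof. exact: glinE. Qed.
Lemma coprod_l_tens (x y : kG) : coprod_l (tens x y) = tens (coprod x) y.
Proof. exact: tens_map_tens. Qed.
Lemma coprod_r_tens (x y : kG) : coprod_r (tens x y) = galgA (tens x (coprod y)).
Proof. by congr galgA; exact: tens_map_tens. Qed.

Lemma one_r_coprod_l F X : is_invariant F ->
  one_r F * coprod_l X = coprod_l X * one_r F.
Proof.
move=> iF; rewrite (galg_linE coprod_l X) mulr_sumr mulr_suml.
apply: eq_bigr => -[g h] _; rewrite -scalerAr -scalerAl; congr (_ *: _).
by rewrite -tens_gelt /= coprod_l_tens /one_r !tensM mulr1 mul1r iF.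
Qed.

Lemma one_l_coprod_r F X : is_invariant F ->
  one_l F * coprod_r X = coprod_r X * one_l F.
Proof.
move=> iF; rewrite (galg_linE coprod_r X) mulr_sumr mulr_suml.
apply: eq_bigr => -[g h] _; rewrite -scalerAr -scalerAl; congr (_ *: _).
rewrite -tens_gelt /= coprod_r_tens /one_l -!galgA_multiplicative !tensM.
by rewrite mulr1 mul1r iF.
Qed.

Lemma coprod_coassoc x : coprod_l (coprod x) = coprod_r (coprod x).
Proof.
rewrite (galg_linE coprod x) (linear_sum coprod_l) (linear_sum coprod_r).
apply: eq_bigr => g _; rewrite (linearZ_LR coprod_l) (linearZ_LR coprod_r).
by rewrite /= coprod_gelt coprod_l_tens coprod_r_tens coprod_gelt galgA_tens.
Qed.

Definition itwist_pred : {pred units kG2} :=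
  fun F => `[< is_twist (uval F) /\ is_invariant (uval F) >].

Lemma itwistP (F : units kG2) :
  reflect (is_twist (uval F) /\ is_invariant (uval F)) (F \in itwist_pred).
Proof. exact: asboolP. Qed.

Fact itwist_group : group_closed itwist_pred.
Proof.
split=> [|F F' /itwistP[[_ tF] iF] /itwistP[[_ tF'] iF']].
  apply/itwistP; split=> [|a]; last by rewrite val_units1 mulr1 mul1r.
  split; first exact: unitr1.
  by rewrite val_units1 coprod_l1 coprod_r1 one_l1 one_r1.
have uF' := units_valP F'.
have iV : is_invariant (uval F')^-1.
  by move=> a; apply: commrV; exact: iF'.
have tV : one_r (uval F')^-1 * coprod_l (uval F')^-1 =
          one_l (uval F')^-1 * coprod_r (uval F')^-1.
  rewrite (morph_unitV one_r1 one_rM uF') (morph_unitV one_l1 one_lM uF').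
  rewrite (morph_unitV coprod_l1 coprod_lM uF').
  rewrite (morph_unitV coprod_r1 coprod_rM uF').
  have ur := morph_unit one_r1 one_rM uF'.
  have ul := morph_unit one_l1 one_lM uF'.
  have cl := morph_unit coprod_l1 coprod_lM uF'.
  have cr := morph_unit coprod_r1 coprod_rM uF'.
  by rewrite -!invrM // -one_r_coprod_l // tF' one_l_coprod_r.
apply/itwistP; rewrite val_unitsM val_unitsV; split; last first.
  by move=> a; rewrite mulrA iF -mulrA iV mulrA.
split; first by rewrite unitrMl ?unitrV //; exact: units_valP.
rewrite one_rM coprod_lM one_lM coprod_rM.
rewrite mulrA -(mulrA (one_r (uval F))) one_r_coprod_l // mulrA tF -mulrA tV.
by rewrite mulrA -(mulrA _ (coprod_r (uval F))) -one_l_coprod_r // !mulrA.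
Qed.

Record itwist := ITwist { itwist_val :> units kG2; _ : itwist_val \in itwist_pred }.
HB.instance Definition _ := [isSub for itwist_val].
HB.instance Definition _ := [Choice of itwist by <:].
HB.instance Definition _ := SubChoice_isSubGroup.Build _ _ itwist itwist_group.

Definition central_unit_pred : {pred units kG} :=
  fun a => `[< forall b : kG, uval a * b = b * uval a >].

Lemma central_unitP (a : units kG) :
  reflect (forall b : kG, uval a * b = b * uval a) (a \in central_unit_pred).
Proof. exact: asboolP. Qed.

Fact central_unit_group : group_closed central_unit_pred.
Proof.
split=> [|a a' /central_unitP ca /central_unitP ca'].
  by apply/central_unitP=> b; rewrite val_units1 mulr1 mul1r.
apply/central_unitP=> b; rewrite val_unitsM val_unitsV -mulrA.
by rewrite -(commrV (esym (ca' b))) mulrA ca mulrA.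
Qed.

Record central_unit :=
  CentralUnit { cunit_val :> units kG; _ : cunit_val \in central_unit_pred }.
HB.instance Definition _ := [isSub for cunit_val].
HB.instance Definition _ := [Choice of central_unit by <:].
HB.instance Definition _ :=
  SubChoice_isSubGroup.Build _ _ central_unit central_unit_group.

Lemma cunitC (a : central_unit) (b : kG) : uval a * b = b * uval a.
Proof. by have /central_unitP := valP a; apply. Qed.

Lemma tens_cunitC (a : central_unit) (X : kG2) :
  tens (uval a) (uval a) * X = X * tens (uval a) (uval a).
Proof.
rewrite (galg_sumE X) mulr_sumr mulr_suml; apply: eq_bigr => -[g h] _.
by rewrite -scalerAr -scalerAl -tens_gelt !tensM !cunitC.
Qed.

Lemma tens_unit (x y : kG) : x \is a GRing.unit -> y \is a GRing.unit ->
  tens x y \is a GRing.unit.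
Proof.
move=> ux uy; apply/unitrP; exists (tens x^-1 y^-1).
by rewrite !tensM !mulVr // !mulrV // tens11.
Qed.

Fact delta1_unit (a : central_unit) :
  tens (uval a) (uval a) * coprod (uval a)^-1 \is a GRing.unit.
Proof.
have ua := units_valP a.
rewrite unitrMl; last by rewrite (morph_unit coprod1 coprodM) ?unitrV.
exact: tens_unit.
Qed.

Fact delta1_subproof (a : central_unit) : Units (delta1_unit a) \in itwist_pred.
Proof.
have ua := units_valP a.
have coV : coprod (uval a) * coprod (uval a)^-1 = 1.
  by rewrite -coprodM mulrV // coprod1.
apply/itwistP; split=> /=; last first.
  move=> b; rewrite mulrA -tens_cunitC -mulrA -coprodM.
  by rewrite (commrV (esym (cunitC a b))) coprodM mulrA.
split; first exact: delta1_unit.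
rewrite coprod_lM coprod_rM coprod_l_tens coprod_r_tens coprod_coassoc !mulrA.
congr (_ * _); rewrite /one_r /one_l -galgA_multiplicative !tensM !mul1r.
have -> : tens (uval a) (uval a) * coprod (uval a)^-1 * coprod (uval a) =
    tens (uval a) (uval a).
  by rewrite -mulrA -coprodM mulVr // coprod1 mulr1.
by rewrite galgA_tens.
Qed.

Definition delta1 (a : central_unit) : itwist := ITwist (delta1_subproof a).

Lemma itwist_inj : injective (fun F : itwist => uval F).
Proof. by move=> F F' /units_inj; exact: val_inj. Qed.

Lemma uval_itwistM (F F' : itwist) : uval (F * F')%g = uval F * uval F'.
Proof. by []. Qed.
Lemma uval_itwist1 : uval (1%g : itwist) = 1.
Proof. by []. Qed.
Lemma uval_cunitM (a b : central_unit) : uval (a * b)%g = uval a * uval b.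
Proof. by []. Qed.
Lemma uval_cunit1 : uval (1%g : central_unit) = 1.
Proof. by []. Qed.
Lemma uval_delta1 (a : central_unit) :
  uval (delta1 a) = tens (uval a) (uval a) * coprod (uval a)^-1.
Proof. by []. Qed.

Lemma delta1C (a : central_unit) (F : itwist) : (delta1 a * F = F * delta1 a)%g.
Proof.
apply: itwist_inj; rewrite !uval_itwistM uval_delta1.
have /itwistP[_ iF] := valP F.
by rewrite -mulrA iF mulrA (tens_cunitC a (uval F)) mulrA.
Qed.

Fact delta1_morphism : monoid.monoid_morphism delta1.
Proof.
split=> [|a b]; apply: itwist_inj.
  by rewrite uval_delta1 uval_itwist1 uval_cunit1 tens11 mul1r invr1 coprod1.
rewrite uval_itwistM !uval_delta1 uval_cunitM -tensM.
rewrite cunitC invrM; try exact: units_valP.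
rewrite coprodM !mulrA; congr (_ * _).
by rewrite -!mulrA (tens_cunitC b (coprod _)).
Qed.
HB.instance Definition _ := isUMagmaMorphism.Build _ _ delta1 delta1_morphism.

Definition delta1_image_pred : {pred itwist} := fun F => `[< exists a, F = delta1 a >].

Lemma delta1_imageP F : reflect (exists a, F = delta1 a) (F \in delta1_image_pred).
Proof. exact: asboolP. Qed.

Fact delta1_image_group : group_closed delta1_image_pred.
Proof.
split; first by apply/delta1_imageP; exists 1%g; rewrite gmulf1.
move=> _ _ /delta1_imageP[a ->] /delta1_imageP[b ->].
by apply/delta1_imageP; exists (a * b^-1)%g; rewrite gmulfF.
Qed.

Fact delta1_image_norm (F F' : itwist) :
  F \in delta1_image_pred -> (F ^ F')%g \in delta1_image_pred.
Proof.
move=> /delta1_imageP[a ->]; apply/delta1_imageP; exists a.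
by rewrite conjgE delta1C mulKg.
Qed.

Definition delta1_image : normal_subgroup itwist :=
  NormalSubgroup delta1_image_group delta1_image_norm.

Definition H2lazy := quotg delta1_image.
HB.instance Definition _ := Group.on H2lazy.

Definition normalizes_G (a : units kG) : Prop :=
  forall x : kG, (exists g, x = gelt k g) <->
    (exists g, x = uval a * gelt k g * (uval a)^-1).

Definition Int_k : {set {perm G}} :=
  [set s in Aut [set: G] | `[< exists2 a : units kG, normalizes_G a &
     forall g, gelt k (s g) = uval a * gelt k g * (uval a)^-1 >]].

End LazyCohomology.

Definition Inn (G : finGroupType) : {set {perm G}} :=
  conj_aut [set: G]%G @: [set: G].

(* Inhomogeneous, non-normalized cochains; T acts trivially on k^x. *)
Section GroupCohomology.
Variables (k : fieldType) (T : groupType).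
Local Open Scope group_scope.

Definition cochain2 := T -> T -> units k.
HB.instance Definition _ := Choice.copy cochain2 (T -> T -> units k).
Implicit Types c d : cochain2.

Definition cochain2_one : cochain2 := fun _ _ => 1.
Definition cochain2_mul c d : cochain2 := fun x y => c x y * d x y.
Definition cochain2_inv c : cochain2 := fun x y => (c x y)^-1.

Fact cochain2_mulA : associative cochain2_mul.
Proof. by move=> c d e; do 2![apply: funext => ?]; exact: mulgA. Qed.
Fact cochain2_mul1 : left_id cochain2_one cochain2_mul.
Proof. by move=> c; do 2![apply: funext => ?]; exact: mul1g. Qed.
Fact cochain2_mulr1 : right_id cochain2_one cochain2_mul.
Proof. by move=> c; do 2![apply: funext => ?]; exact: mulg1. Qed.
Fact cochain2_mulV : left_inverse cochain2_one cochain2_inv cochain2_mul.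
Proof. by move=> c; do 2![apply: funext => ?]; exact: mulVg. Qed.
Fact cochain2_mulVr : right_inverse cochain2_one cochain2_inv cochain2_mul.
Proof. by move=> c; do 2![apply: funext => ?]; exact: mulgV. Qed.
HB.instance Definition _ := isGroup.Build cochain2
  cochain2_mulA cochain2_mul1 cochain2_mulr1 cochain2_mulV cochain2_mulVr.

Definition is_cocycle2 c : Prop :=
  forall x y z, c y z * c x (y * z) = c (x * y) z * c x y.

Definition cocycle2_pred : {pred cochain2} := fun c => `[< is_cocycle2 c >].

Lemma cocycle2P c : reflect (is_cocycle2 c) (c \in cocycle2_pred).
Proof. exact: asboolP. Qed.

Fact cocycle2_group : group_closed cocycle2_pred.
Proof.
split=> [|c d /cocycle2P zc /cocycle2P zd]; apply/cocycle2P=> x y z //.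
apply: units_inj; move: (congr1 (@uval k) (zc x y z)) (congr1 (@uval k) (zd x y z)).
rewrite !val_unitsM !val_unitsV => zc' zd'.
by rewrite mulrACA [in RHS]mulrACA -!invfM zc' zd'.
Qed.

Record cocycle2 := Cocycle2 { cocycle2_val : cochain2; _ : cocycle2_val \in cocycle2_pred }.
HB.instance Definition _ := [isSub for cocycle2_val].
HB.instance Definition _ := [Choice of cocycle2 by <:].
HB.instance Definition _ := SubChoice_isSubGroup.Build _ _ cocycle2 cocycle2_group.

Lemma cocycle2C (c d : cocycle2) : c * d = d * c.
Proof. by apply: val_inj; apply: funext => x; apply: funext => y; exact: unitsC. Qed.

Definition cobound (f : T -> units k) : cochain2 :=
  fun x y => f y * (f (x * y))^-1 * f x.

Definition coboundary2_pred : {pred cocycle2} :=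
  fun c : cocycle2 => `[< exists f, cocycle2_val c = cobound f >].

Lemma coboundary2P (c : cocycle2) :
  reflect (exists f, cocycle2_val c = cobound f) (c \in coboundary2_pred).
Proof. exact: asboolP. Qed.

Lemma cobound_cocycle f : is_cocycle2 (cobound f).
Proof.
move=> x y z; apply: units_inj; rewrite /cobound (mulgA x y z) !(val_unitsM, val_unitsV).
by field; rewrite !uval_neq0.
Qed.

Fact coboundary2_group : group_closed coboundary2_pred.
Proof.
split.
  apply/coboundary2P; exists (fun=> 1); apply: funext => x; apply: funext => y.
  by rewrite /cobound invg1 !mulg1.
move=> /= c d /coboundary2P[f cf] /coboundary2P[f' df].
apply/coboundary2P; exists (fun x => f x * (f' x)^-1); apply: funext => x; apply: funext => y.
apply: units_inj; have := congr1 (fun h => h x y) cf.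
have := congr1 (fun h => h x y) df; rewrite /cobound => dxy cxy.
rewrite (_ : cocycle2_val (c * d^-1) x y =
  cocycle2_val c x y * (cocycle2_val d x y)^-1) // cxy dxy.
by rewrite !(val_unitsM, val_unitsV); field; rewrite !uval_neq0.
Qed.

Fact coboundary2_norm (c d : cocycle2) :
  c \in coboundary2_pred -> c ^ d \in coboundary2_pred.
Proof.
by rewrite conjgE (cocycle2C c) mulKg.
Qed.

Definition coboundary2 : normal_subgroup cocycle2 :=
  NormalSubgroup coboundary2_group coboundary2_norm.

Definition H2 := quotg coboundary2.
HB.instance Definition _ := Group.on H2.

End GroupCohomology.

Section Pullback.
Variables (k : fieldType) (T T' : groupType) (f : {multiplicative T -> T'}).
Local Open Scope group_scope.

Definition cochain2_pull (c : cochain2 k T') : cochain2 k T :=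
  fun x y => c (f x) (f y).

Fact cocycle2_pull_subproof (c : cocycle2 k T') :
  cochain2_pull (cocycle2_val c) \in @cocycle2_pred k T.
Proof.
apply/cocycle2P=> x y z; rewrite /cochain2_pull !gmulfM.
by have /cocycle2P := valP c; apply.
Qed.
Definition cocycle2_pull (c : cocycle2 k T') : cocycle2 k T :=
  Cocycle2 (cocycle2_pull_subproof c).

Definition H2_pull (u : H2 k T') : H2 k T :=
  to_quotg (coboundary2 k T) (cocycle2_pull (repr u)).

Lemma H2_pullE (c : cocycle2 k T') :
  H2_pull (to_quotg _ c) = to_quotg _ (cocycle2_pull c).
Proof.
rewrite /H2_pull; apply/to_quotgP.
have /to_quotgP := to_quotg_repr (to_quotg (coboundary2 k T') c).
move: (repr _) => d /coboundary2P[h Hh].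
apply/coboundary2P; exists (h \o f).
do 2![apply: funext => ?]; rewrite /= /cobound /= gmulfM.
exact: (congr1 (fun c => c (f _) (f _)) Hh).
Qed.

Lemma H2_pullM : {morph H2_pull : u v / u * v}.
Proof.
move=> u v; rewrite -(to_quotg_repr u) -(to_quotg_repr v).
by rewrite -to_quotgM !H2_pullE -to_quotgM; congr to_quotg; exact: val_inj.
Qed.

End Pullback.

Section Characters.
Variables (k : fieldType) (gT : finGroupType) (A : {group gT}).
Local Open Scope group_scope.

Definition charg_pred : {pred {ffun subg_of A -> units k}} :=
  fun chi => [forall x, forall y, chi (x * y) == chi x * chi y].

Lemma charg_predP (chi : {ffun subg_of A -> units k}) :
  reflect {morph chi : x y / x * y} (chi \in charg_pred).
Proof.
apply: (iffP forallP) => [H x y|H x]; first by apply/eqP; have /forallP := H x; apply.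
by apply/forallP=> y; apply/eqP.
Qed.

Fact charg_group : group_closed charg_pred.
Proof.
split=> [|chi psi /charg_predP mchi /charg_predP mpsi]; apply/charg_predP=> x y.
  by rewrite !ffunE mulg1.
rewrite !ffunE mchi mpsi; apply: units_inj; rewrite !(val_unitsM, val_unitsV).
by field; rewrite !uval_neq0.
Qed.

Record charg := Charg { charg_val :> {ffun subg_of A -> units k}; _ : charg_val \in charg_pred }.
HB.instance Definition _ := [isSub for charg_val].
HB.instance Definition _ := [Choice of charg by <:].
HB.instance Definition _ := SubChoice_isSubGroup.Build _ _ charg charg_group.

Hypothesis nA : A <| [set: gT].

Fact charg_conj_subproof (g : gT) (chi : charg) :
  [ffun a : subg_of A => chi (subg A (sgval a ^ g))] \in charg_pred.
Proof.
apply/charg_predP=> x y; rewrite !ffunE.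
have memJ (z : subg_of A) : sgval z ^ g \in A.
  by rewrite memJ_norm ?subgP //; have /andP[_ /subsetP] := nA; apply; rewrite inE.
have E (z : subg_of A) : sgval (subg A (sgval z ^ g)) = sgval z ^ g.
  by rewrite subgK ?memJ.
have /charg_predP <- := valP chi; congr (chi _).
apply: val_inj; rewrite /= conjMg !E.
by rewrite subgK // groupM // memJ.
Qed.

(* a ^ g is g^-1 a g, so this is a left action of G. *)
Definition charg_conj (g : gT) (chi : charg) : charg :=
  Charg (charg_conj_subproof g chi).

Fact charg_conjM (g : gT) : {morph charg_conj g : chi psi / chi * psi}.
Proof. by move=> chi psi; apply: val_inj; apply/ffunP=> a; rewrite !ffunE. Qed.
HB.instance Definition _ (g : gT) :=
  isMultiplicative.Build charg charg (charg_conj g) (@charg_conjM g).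

(* (g . c)(chi, psi) = c (g^-1 . chi, g^-1 . psi) on cocycles *)
Definition H2_act (g : gT) : H2 k charg -> H2 k charg := H2_pull (charg_conj g^-1).

Definition H2_inv_pred : {pred H2 k charg} :=
  fun u => `[< forall g, H2_act g u = u >].

Lemma H2_invP u : reflect (forall g, H2_act g u = u) (u \in H2_inv_pred).
Proof. exact: asboolP. Qed.

Lemma H2_actM g : {morph H2_act g : u v / u * v}.
Proof. exact: H2_pullM. Qed.

Fact H2_inv_group : group_closed H2_inv_pred.
Proof.
have act1 g : H2_act g 1 = 1.
  by apply: (mulgI (H2_act g 1)); rewrite -H2_actM !mulg1.
split=> [|u v /H2_invP iu /H2_invP iv]; apply/H2_invP=> g; first exact: act1.
rewrite H2_actM iu; congr (_ * _); apply: (mulgI v).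
by rewrite -{1}(iv g) -H2_actM mulgV.
Qed.

Record H2_inv := H2Inv { H2_inv_val : H2 k charg; _ : H2_inv_val \in H2_inv_pred }.
HB.instance Definition _ := [isSub for H2_inv_val].
HB.instance Definition _ := [Choice of H2_inv by <:].
HB.instance Definition _ := SubChoice_isSubGroup.Build _ _ H2_inv H2_inv_group.

End Characters.

Definition unique_max_abelian_normal (G : finGroupType) (A : {group G}) : Prop :=
  [max A | A <| [set: G] & abelian A]%g /\
  forall B : {group G}, [max B | B <| [set: G] & abelian B]%g -> B = A.

Lemma unique_max_abelian_normal_normal (G : finGroupType) (A : {group G}) :
  unique_max_abelian_normal A -> (A <| [set: G])%g.
Proof. by case=> /maxgroupp/andP[]. Qed.

(* Main.v *)
Require Import Defs.
From HB Require Import structures.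
From mathcomp Require Import all_boot all_order all_algebra all_fingroup.
From mathcomp Require Import all_solvable all_field generic_quotient.
From mathcomp Require Import ring.
From mathcomp Require Import boolp.

Set Implicit Arguments.
Unset Strict Implicit.
Unset Printing Implicit Defensive.

Import GRing.Theory VectorInternalTheory.
Local Open Scope ring_scope.

(* Let [R = F_21 F^-1] for an invariant twist [F].  The twist equation and the
   invariance give [(Delta (x) id) R = R_13 R_23], so that the rows of [R] are
   orthogonal idempotents, and likewise its columns; hence the elements of [G]
   occurring in [R] commute with each other.  As [R] is invariant, they generate
   abelian normal subgroups, so [R] lies in [k[A] (x) k[A]] and is the Fourier
   transform of a [G]-invariant skew bicharacter [b] of the dual of [A].  Since
   [A] has odd order, [b] has a square root, which defines an invariant twist
   [F'] with [F'_21 F'^-1 = R]; then [F'^-1 F] is symmetric.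

   A symmetric invariant twist [S] makes the dual of [k[G]] a commutative algebra;
   a character of it is an invertible [a] with [Delta(a) S = a (x) a], conjugation
   by [a] preserves [G] and, as it is inner, [a] may be replaced by a central
   unit, so [S] is in the image of [delta1].

   On the other side, a class in [H^2] of the dual of [A] is determined by its
   alternation [c(x,y) / c(y,x)], a skew bicharacter, and sending it to the twist
   attached to the square root of the alternation is the isomorphism. *)

(** * Common eigenvectors of commuting endomorphisms *)

Section CommonEigenvector.
Variables (k : closedFieldType) (V : vectType k).

(** In coordinates the restriction of [f] to [U] is a square matrix of positive size, so its
    characteristic polynomial has a root in [k]. *)
Lemma eigenvector_in (f : 'End(V)) (U : {vspace V}) :
    U != 0%VS -> (f @: U <= U)%VS ->
  exists a v, [/\ v \in U, v != 0 & f v = a *: v].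
Proof.
move=> U0 fU.
pose phi := v2r \o vsproj U \o f \o vsval \o (@r2v _ (subvs_of U)).
pose M := lin1_mx phi.
have [a] : exists a, eigenvalue M a.
  have /closed_rootP[a rMa] : size (char_poly M) != 1%N.
    by rewrite size_char_poly eqSS -[X in (X == _)]/(\dim U) dimv_eq0.
  by exists a; rewrite eigenvalue_root_char.
case/eigenvalueP=> w wM w0; exists a, (vsval (r2v w)); split.
- exact: subvsP.
- apply: contraNneq w0 => r0; rewrite -(r2vK w); apply/eqP.
  by rewrite (_ : r2v w = 0) ?linear0 //; apply: val_inj; rewrite /= r0.
have : phi w = a *: w by rewrite -wM mul_rV_lin1.
move/(congr1 (@r2v _ (subvs_of U))); rewrite /phi /= v2rK linearZ /=.
move/(congr1 vsval); rewrite vsprojK ?linearZ //=.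
by apply: (subvP fU); apply: memv_img; apply: subvsP.
Qed.

(** Induction on the dimension. If every [f i] is scalar on [U], any nonzero vector will do;
    otherwise some [f i] has a nonzero proper eigenspace in [U], which the other operators preserve
    because they commute with [f i]. *)
Lemma common_eigenvector (I : Type) (f : I -> 'End(V)) (U : {vspace V}) :
    (forall i j v, f i (f j v) = f j (f i v)) ->
    U != 0%VS -> (forall i, (f i @: U <= U)%VS) ->
  exists2 v, v \in U & v != 0 /\ forall i, exists a, f i v = a *: v.
Proof.
move=> fC; have [d] := ubnP (\dim U).
elim: d U => // d IH U ltUd U0 fU.
have [sc|/existsNP[i nsc]] := pselect (forall i, exists a, forall v, v \in U -> f i v = a *: v).
  exists (vpick U); rewrite ?memv_pick // vpick0; split=> // i.
  by have [a fa] := sc i; exists a; apply: fa; apply: memv_pick.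
have [a [v [vU v0 fv]]] := eigenvector_in U0 (fU i).
have memK w : (w \in lker (f i - a *: \1%VF)) = (f i w == a *: w).
  by rewrite memv_ker !lfun_simp subr_eq0.
have [] := IH (U :&: lker (f i - a *: \1%VF))%VS.
- apply: leq_trans (_ : \dim U <= d)%N; last by rewrite -ltnS.
  rewrite ltnNge; apply/negP=> dU; apply: nsc; exists a => w wU.
  apply/eqP; rewrite -memK.
  have /eqP : (U :&: lker (f i - a *: \1%VF) = U)%VS.
    by apply/eqP; rewrite eqEdim capvSl.
  by rewrite eqEsubv => /andP[_ /subvP/(_ w wU)]; rewrite memv_cap => /andP[].
- apply: contraNneq v0 => K0; rewrite -memv0 -K0 memv_cap vU memK.
  exact/eqP.
- move=> j; apply/subvP=> _ /memv_imgP[w + ->].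
  rewrite !memv_cap !memK => /andP[wU /eqP fw]; apply/andP; split.
    by apply: (subvP (fU j)); apply: memv_img.
  by rewrite fC fw linearZ.
by move=> w; rewrite memv_cap => /andP[wU _] ?; exists w.
Qed.

End CommonEigenvector.

(** * Linear maps between group algebras, and slices of tensors *)

Section GroupAlgebraMaps.
Variable k : fieldType.
Implicit Types G H K : finGroupType.

Lemma galg_lin_ext G (V : lmodType k) (f f' : {linear galg k G -> V}) :
  (forall g, f (gelt k g) = f' (gelt k g)) -> f =1 f'.
Proof.
by move=> E x; rewrite !galg_linE; apply: eq_bigr => g _; rewrite E.
Qed.

Definition galg_map G H (phi : G -> H) : galg k G -> galg k H :=
  glin (fun g => gelt k (phi g)).
HB.instance Definition _ G H (phi : G -> H) := GRing.Linear.on (galg_map phi).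

Lemma galg_map_gelt G H (phi : G -> H) g :
  galg_map phi (gelt k g) = gelt k (phi g).
Proof. exact: glinE. Qed.

Lemma eq_galg_map G H (phi psi : G -> H) :
  phi =1 psi -> galg_map phi =1 galg_map psi.
Proof. by move=> E; apply: galg_lin_ext => g /=; rewrite !galg_map_gelt E. Qed.

Lemma galg_map_comp G H K (psi : H -> K) (phi : G -> H) x :
  galg_map psi (galg_map phi x) = galg_map (psi \o phi) x.
Proof.
apply: (@galg_lin_ext G _ (galg_map psi \o galg_map phi) (galg_map (psi \o phi))).
by move=> g /=; rewrite !galg_map_gelt.
Qed.

Lemma galg_map_id G (phi : G -> G) : phi =1 id -> galg_map phi =1 id.
Proof. by move=> E; apply: (galg_lin_ext (f' := idfun)) => g /=; rewrite galg_map_gelt E. Qed.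

Lemma galg_map_inj G H (phi : G -> H) (x : galg k G) g :
  injective phi -> galg_map phi x (phi g) = x g.
Proof.
move=> inj; rewrite /galg_map /glin sum_ffunE (bigD1 g) //= !ffunE eqxx.
rewrite big1 ?addr0 => [|h nhg]; first exact: mulr1.
rewrite !ffunE (inj_eq inj) eq_sym (negPf nhg); exact: mulr0.
Qed.

Lemma galg_mapM G H (phi : G -> H) : {morph phi : g h / (g * h)%g} ->
  {morph galg_map phi : x y / x * y}.
Proof. by move=> phiM; apply: glin_multiplicative => g h; rewrite phiM geltM. Qed.

Lemma galg_map1 G H (phi : G -> H) : {morph phi : g h / (g * h)%g} ->
  galg_map phi 1 = 1.
Proof.
move=> phiM; rewrite -gelt1 galg_map_gelt -gelt1; congr gelt.
by apply: (mulgI (phi 1%g)); rewrite -phiM !mulg1.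
Qed.

Fact tensl_linear G H (y : galg k H) : linear (@tens k G H ^~ y).
Proof.
move=> a x x'; apply/ffunP=> p; rewrite !ffunE /=.
by rewrite mulrDl; congr (_ + _); symmetry; exact: mulrA.
Qed.
Definition tensl G H (y : galg k H) := fun x => @tens k G H x y.
HB.instance Definition _ G H (y : galg k H) :=
  GRing.isLinear.Build k (galg k G) _ _ (@tensl G H y) (@tensl_linear G H y).

Fact tensr_linear G H (x : galg k G) : linear (@tens k G H x).
Proof.
move=> a y y'; apply/ffunP=> p; rewrite !ffunE /=.
by rewrite mulrDr; congr (_ + _); exact: mulrCA.
Qed.
HB.instance Definition _ G H (x : galg k G) :=
  GRing.isLinear.Build k (galg k H) _ _ (@tens k G H x) (@tensr_linear G H x).

Lemma tens_suml G H I (r : seq I) (F : I -> galg k G) (y : galg k H) :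
  tens (\sum_(i <- r) F i) y = \sum_(i <- r) tens (F i) y.
Proof. exact: (linear_sum (tensl y)). Qed.

Lemma tensZl G H a (x : galg k G) (y : galg k H) : tens (a *: x) y = a *: tens x y.
Proof. exact: (linearZ_LR (tensl y)). Qed.

Lemma tensZr G H a (x : galg k G) (y : galg k H) : tens x (a *: y) = a *: tens x y.
Proof. exact: linearZ_LR. Qed.

(** The row of [X] at [g], when [X] is read as a matrix indexed by [G] and [H]. *)
Definition slice G H (X : galg k (prodG G H)) (g : G) : galg k H :=
  [ffun h => X (g, h)].

Lemma slice_coef G H (X : galg k (prodG G H)) g h : slice X g h = X (g, h).
Proof. exact: ffunE. Qed.

Fact slice_linear G H (g : G) : linear (fun X => @slice G H X g).
Proof. by move=> a X Y; apply/ffunP=> h; rewrite !ffunE. Qed.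
Definition slicel G H (g : G) X := @slice G H X g.
HB.instance Definition _ G H (g : G) :=
  GRing.isLinear.Build k _ (galg k H) _ (@slicel G H g) (@slice_linear G H g).

Lemma slice_sum G H (X : galg k (prodG G H)) :
  X = \sum_g tens (gelt k g) (slice X g).
Proof.
apply/ffunP=> -[g h]; rewrite sum_ffunE (bigD1 g) //= !ffunE eqxx /=.
rewrite big1 ?addr0 => [|g' /negPf ng]; first by rewrite mul1r.
by rewrite !ffunE /= eq_sym ng mul0r.
Qed.

Lemma sliceE G H (y : G -> galg k H) g :
  slice (\sum_g' tens (gelt k g') (y g')) g = y g.
Proof.
apply/ffunP=> h; rewrite ffunE sum_ffunE (bigD1 g) //= !ffunE eqxx /= mul1r.
by rewrite big1 ?addr0 // => g' /negPf ng; rewrite !ffunE /= eq_sym ng mul0r.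
Qed.

End GroupAlgebraMaps.

Lemma tens_geltl (k : fieldType) (G H : finGroupType) (g : G) (y : galg k H) :
  tens (gelt k g) y = \sum_h (y h : k) *: gelt k ((g, h) : prodG G H).
Proof.
rewrite {1}(galg_sumE y) linear_sum; apply: eq_bigr => h _.
by rewrite linearZ_LR /= tens_gelt.
Qed.

(** * Leg notation and the hexagon identity *)

Section Twists.
Variables (k : fieldType) (G : finGroupType).
Local Notation kG := (galg k G).
Local Notation G3 := (prodG (prodG G G) G).
Local Notation kG2 := (galg k (prodG G G)).
Local Notation kG3 := (galg k G3).
Implicit Types F X : kG2.

Definition flip : kG2 -> kG2 := galg_map (fun p : prodG G G => (p.2, p.1) : prodG G G).
HB.instance Definition _ := GRing.Linear.on flip.

Lemma flipK : involutive flip.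
Proof. by move=> X; rewrite /flip galg_map_comp galg_map_id // => -[]. Qed.

Lemma flipM : {morph flip : X Y / X * Y}.
Proof. by apply: galg_mapM => -[? ?] -[? ?]. Qed.

Lemma flip1 : flip 1 = 1.
Proof. by apply: galg_map1 => -[? ?] -[? ?]. Qed.

Lemma flipE X g h : flip X (g, h) = X (h, g).
Proof.
rewrite /flip -[(g, h)]/((fun p : prodG G G => (p.2, p.1)) (h, g)).
by rewrite galg_map_inj // => -[? ?] -[? ?] [-> ->].
Qed.

Lemma flip_tens (x y : kG) : flip (tens x y) = tens y x.
Proof. by apply/ffunP=> -[g h]; rewrite flipE !ffunE /= mulrC. Qed.

Lemma flip_coprod (x : kG) : flip (coprod x) = coprod x.
Proof.
apply: (@galg_lin_ext _ _ _ (flip \o @coprod k G) (@coprod k G)) => g /=.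
by rewrite coprod_gelt flip_tens.
Qed.

(* In leg notation [X_31] is [leg (fun g h => (h, 1, g)) X], and
   [(Delta (x) id) X = X_{12,3}] is [leg (fun g h => (g, g, h)) X]. *)
Definition leg (phi : G -> G -> G3) : kG2 -> kG3 :=
  galg_map (fun p : prodG G G => phi p.1 p.2).
HB.instance Definition _ (phi : G -> G -> G3) := GRing.Linear.on (leg phi).

Lemma legM (phi : G -> G -> G3) :
  (forall g h g' h', phi (g * g')%g (h * h')%g = (phi g h * phi g' h')%g) ->
  {morph leg phi : X Y / X * Y}.
Proof. by move=> H; apply: galg_mapM => -[? ?] -[? ?]; exact: H. Qed.

Lemma coprod_l_leg X : coprod_l X = leg (fun g h => (g, g, h)) X.
Proof.
apply: (@galg_lin_ext _ _ _ (@coprod_l k G) (leg (fun g h => (g, g, h)))) => -[g h] /=.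
by rewrite -tens_gelt coprod_l_tens coprod_gelt !tens_gelt /leg galg_map_gelt.
Qed.

Lemma coprod_r_leg X : coprod_r X = leg (fun g h => (g, h, h)) X.
Proof.
apply: (@galg_lin_ext _ _ _ (@coprod_r k G) (leg (fun g h => (g, h, h)))) => -[g h] /=.
by rewrite -tens_gelt coprod_r_tens coprod_gelt galgA_tens !tens_gelt /leg galg_map_gelt.
Qed.

Lemma one_r_leg X : one_r X = leg (fun g h => (g, h, 1%g)) X.
Proof.
apply: (@galg_lin_ext _ _ _ (@tensl k _ _ (1 : kG)) (leg (fun g h => (g, h, 1%g)))) => -[g h].
rewrite /= /leg; rewrite galg_map_gelt; exact: (tens_gelt k ((g, h) : prodG G G) (1%g : G)).
Qed.

Lemma one_l_leg X : one_l X = leg (fun g h => (1%g, g, h)) X.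
Proof.
apply: (@galg_lin_ext _ _ _ (@galgA k G G G \o @tens k _ _ (1 : kG)) (leg (fun g h =>
  (1%g, g, h)))) => -[g h] /=.
rewrite -tens_gelt -?(gelt1 k G) galgA_tens (tens_gelt k (1%g : G)) !tens_gelt.
by rewrite /leg galg_map_gelt.
Qed.

Lemma leg_map (pi : G3 -> G3) (phi : G -> G -> G3) X :
  galg_map pi (leg phi X) = leg (fun g h => pi (phi g h)) X.
Proof. by rewrite /leg galg_map_comp; apply: eq_galg_map. Qed.

Lemma leg_flip (phi : G -> G -> G3) X : leg phi (flip X) = leg (fun g h => phi h g) X.
Proof. by rewrite /leg /flip galg_map_comp; apply: eq_galg_map. Qed.

Lemma leg_unit (phi : G -> G -> G3) X :
  (forall g h g' h', phi (g * g')%g (h * h')%g = (phi g h * phi g' h')%g) ->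
  X \is a GRing.unit -> leg phi X \is a GRing.unit.
Proof.
move=> H; apply: morph_unit; last exact: legM.
by apply: galg_map1 => -[? ?] -[? ?]; exact: H.
Qed.

Lemma flip_unit X : X \is a GRing.unit -> flip X \is a GRing.unit.
Proof. exact: (morph_unit flip1 flipM). Qed.

Lemma flip_invariant F : is_invariant F -> is_invariant (flip F).
Proof. by move=> iF a; rewrite -flip_coprod -!flipM iF. Qed.

Lemma twist_legs F : is_twist F ->
  leg (fun g h => (g, h, 1%g)) F * leg (fun g h => (g, g, h)) F =
  leg (fun g h => (1%g, g, h)) F * leg (fun g h => (g, h, h)) F.
Proof. by case=> _; rewrite one_r_leg one_l_leg coprod_l_leg coprod_r_leg. Qed.

Lemma flip_twist F : is_twist F -> is_twist (flip F).
Proof.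
move=> tF; split; first by apply: flip_unit; case: tF.
rewrite one_r_leg one_l_leg coprod_l_leg coprod_r_leg !leg_flip.
pose pi (p : G3) : G3 := (p.2, p.1.2, p.1.1).
have piM : {morph @galg_map k G3 G3 pi : x y / x * y} by apply: (@galg_mapM k G3 G3) =>
  -[[? ?] ?] -[[? ?] ?].
by have /(congr1 (galg_map pi)) := twist_legs tF; rewrite !piM !leg_map /=.
Qed.

Definition rmat F : kG2 := flip F * F^-1.

(** After right multiplication by the units [F_{12,3}] and [F_12], both sides become
    [F_31 F_{13,2}]. [E1] and [E2] are the twist equation with its legs permuted, where
    cocommutativity absorbs any exchange of the two legs of a coproduct; [C] lets [F_12] pass the
    image of [Delta (x) id]. *)
Lemma rmat_hexagon F : is_twist F -> is_invariant F ->
  leg (fun g h => (g, g, h)) (rmat F) =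
  leg (fun g h => (g, 1%g, h)) (rmat F) * leg (fun g h => (1%g, g, h)) (rmat F).
Proof.
move=> tF iF; have uF : F \is a GRing.unit by case: tF.
have E := twist_legs tF.
pose pi1 (p : G3) : G3 := (p.1.2, p.2, p.1.1).
pose pi2 (p : G3) : G3 := (p.1.1, p.2, p.1.2).
have pi1M : {morph @galg_map k G3 G3 pi1 : x y / x * y} by apply: (@galg_mapM k G3 G3) =>
  -[[? ?] ?] -[[? ?] ?].
have pi2M : {morph @galg_map k G3 G3 pi2 : x y / x * y} by apply: (@galg_mapM k G3 G3) =>
  -[[? ?] ?] -[[? ?] ?].
have E1 : leg (fun g h => (h, 1%g, g)) F * leg (fun g h => (g, h, g)) F =
    leg (fun g h => (g, h, 1%g)) F * leg (fun g h => (h, h, g)) F.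
  by have := congr1 (galg_map pi1) E; rewrite !pi1M !leg_map.
have E2 : leg (fun g h => (g, 1%g, h)) F * leg (fun g h => (g, h, g)) F =
    leg (fun g h => (1%g, h, g)) F * leg (fun g h => (g, h, h)) F.
  by have := congr1 (galg_map pi2) E; rewrite !pi2M !leg_map.
have C X : leg (fun g h => (g, h, 1%g)) F * leg (fun g h => (g, g, h)) X =
    leg (fun g h => (g, g, h)) X * leg (fun g h => (g, h, 1%g)) F.
  by rewrite -one_r_leg -coprod_l_leg one_r_coprod_l.
have rF : rmat F * F = flip F by rewrite /rmat divrK.
have hM1 : forall g h g' h' : G,
  (g * g', g * g', h * h')%g = (((g, g, h) : G3) * ((g', g', h') : G3))%g :> G3 by [].
have hM2 : forall g h g' h' : G,
  (g * g', 1, h * h')%g = (((g, 1, h)%g : G3) * ((g', 1, h')%g : G3))%g :> G3.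
  by move=> *; rewrite -[in LHS](mulg1 (1%g : G)).
have hM3 : forall g h g' h' : G,
  (1, g * g', h * h')%g = (((1, g, h)%g : G3) * ((1, g', h')%g : G3))%g :> G3.
  by move=> *; rewrite -[in LHS](mulg1 (1%g : G)).
have hM4 : forall g h g' h' : G,
  (g * g', h * h', 1)%g = (((g, h, 1)%g : G3) * ((g', h', 1)%g : G3))%g :> G3.
  by move=> *; rewrite -[in LHS](mulg1 (1%g : G)).
have L phi : (forall g h g' h', phi (g * g')%g (h * h')%g = (phi g h * phi g' h')%g) ->
    leg phi (rmat F) * leg phi F = leg (fun g h => phi h g) F.
  by move=> phiM; rewrite -(legM phiM) rF leg_flip.
apply: (mulIr (leg_unit hM1 uF)); apply: (mulIr (leg_unit hM4 uF)).
rewrite (L _ hM1) -(leg_flip (fun g h => (g, g, h))) -C leg_flip -E1.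
rewrite -[in RHS]mulrA -C E -!mulrA (mulrA (leg _ (rmat F)) (leg _ F) (leg (fun g h =>
  (g, h, h)) F)).
by rewrite (L _ hM3) -E2 mulrA (L _ hM2).
Qed.

(** Read the hexagon identity at [(g, h)] in the first two legs: on the left the coproduct keeps
    only the diagonal, where the rows sit, and on the right one finds the product of two rows. *)
Lemma rmat_slices F g h : is_twist F -> is_invariant F ->
  slice (rmat F) g * slice (rmat F) h = (g == h)%:R *: slice (rmat F) g.
Proof.
move=> tF iF; set R := rmat F.
have LM (phi : G -> G -> G3) : leg phi R = \sum_g \sum_h (R (g, h) : k) *: gelt k (phi g h).
  by rewrite (galg_linE (leg phi)) pair_bigA; apply: eq_bigr => -[? ?] _;
    rewrite /= /leg galg_map_gelt.
have E1 : leg (fun g h => (g, g, h)) R =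
    \sum_(p : prodG G G) tens (gelt k p) ((p.1 == p.2)%:R *: slice R p.1).
  rewrite LM [RHS](eq_bigr (fun p : G * G => tens (gelt k (p : prodG G G))
    ((p.1 == p.2)%:R *: slice R p.1))) //.
  rewrite -(pair_bigA _ (fun g g' => tens (gelt k ((g, g') : prodG G G))
    ((g == g')%:R *: slice R g))) /=.
  apply: eq_bigr => g' _; rewrite [RHS](bigD1 g') //= eqxx scale1r [X in _ + X]big1 ?addr0 =>
    [|h' /negPf ngh].
    by rewrite tens_geltl; apply: eq_bigr => h' _; rewrite slice_coef.
  by rewrite eq_sym ngh scale0r linear0.
have E2 : leg (fun g h => (g, 1%g, h)) R * leg (fun g h => (1%g, g, h)) R =
    \sum_(p : prodG G G) tens (gelt k p) (slice R p.1 * slice R p.2).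
  have S2 : leg (fun g h => (g, 1%g, h)) R = \sum_g tens (gelt k ((g, 1%g) : prodG G G))
    (slice R g).
    rewrite LM; apply: eq_bigr => g' _.
    by rewrite tens_geltl; apply: eq_bigr => h' _; rewrite slice_coef.
  have S3 : leg (fun g h => (1%g, g, h)) R = \sum_g tens (gelt k ((1%g, g) : prodG G G))
    (slice R g).
    rewrite LM; apply: eq_bigr => g' _.
    by rewrite tens_geltl; apply: eq_bigr => h' _; rewrite slice_coef.
  rewrite S2 S3 mulr_suml [RHS](eq_bigr (fun p : G * G =>
    tens (gelt k (p : prodG G G)) (slice R p.1 * slice R p.2))) //.
  rewrite -(pair_bigA _ (fun g g' => tens (gelt k ((g, g') : prodG G G))
    (slice R g * slice R g'))) /=.
  apply: eq_bigr => g' _; rewrite mulr_sumr; apply: eq_bigr => h' _.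
  rewrite tensM -geltM; congr (tens (gelt k _) _).
  by rewrite -[in RHS](mulg1 g') -[in RHS](mul1g h').
have := congr1 (fun X : kG3 => slice X ((g, h) : prodG G G)) (rmat_hexagon tF iF).
by rewrite /= E1 E2 !sliceE.
Qed.

End Twists.

(** * Coefficients and invertibility in the group algebra *)

Section Coefficients.
Variables (k : fieldType) (G : finGroupType).
Local Notation kG := (galg k G).
Implicit Types x y : kG.

Lemma gelt_inj : injective (@gelt k G).
Proof.
move=> g h /ffunP/(_ g); rewrite !ffunE eqxx; case: eqP => // _ /eqP.
by rewrite (negPf (oner_neq0 k)).
Qed.

Lemma gelt_mulE g x h : (gelt k g * x) h = x (g^-1 * h)%g.
Proof.
rewrite [LHS]ffunE (bigD1 g) //= ffunE eqxx mul1r big1 ?addr0 // => u /negPf nu.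
by rewrite ffunE nu mul0r.
Qed.

Lemma mul_geltE x g h : (x * gelt k g) h = x (h * g^-1)%g.
Proof.
rewrite [LHS]ffunE (bigD1 (h * g^-1)%g) //= ffunE invgM invgK -mulgA mulVg mulg1 eqxx mulr1.
rewrite big1 ?addr0 // => u nu; rewrite ffunE; case: eqP => [E|]; last by rewrite mulr0.
by move: nu; rewrite -E invgM invgK mulKVg eqxx.
Qed.

Lemma gelt_unit (g : G) : gelt k g \is a GRing.unit.
Proof. by apply/unitrP; exists (gelt k (g^-1)%g); rewrite -!geltM mulVg mulgV. Qed.

(** The Galois map, from [x (x) y] to [(x (x) 1) Delta(y)], permutes the basis of group elements by
    [(g, h) |-> (g h, h)]; reading it backwards recovers [x] and [y]. *)
Lemma tens_mul_coprodE x y g h :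
  (tens x 1 * coprod y) (g, h) = (x (g * h^-1)%g : k) * y h.
Proof.
have -> : tens x 1 * coprod y = flip (\sum_v tens (gelt k v) ((y v : k) *: (x * gelt k v))).
  rewrite {1}(galg_sumE y) !linear_sum mulr_sumr; apply: eq_bigr => v _ /=.
  by rewrite linearZ /= coprod_gelt flip_tens tensZl -scalerAr tensM mul1r.
rewrite flipE -slice_coef sliceE ffunE mul_geltE.
by rewrite /GRing.scale /= mulrC.
Qed.

Lemma coprod_diag x g : coprod x (g, g) = x g.
Proof.
have := tens_mul_coprodE 1 x g g; rewrite tens11 mul1r mulgV => ->.
by rewrite ffunE eqxx mul1r.
Qed.

Lemma galg_neq0 x : x != 0 -> exists g, x g != 0 :> k.
Proof.
move=> x0; apply/existsP; apply: contraNT x0 => /existsPn H; apply/eqP/ffunP=> g.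
by rewrite [RHS]ffunE; apply/eqP; rewrite -[_ == _]negbK H.
Qed.

(** By finite dimension, injective right multiplication by [x] is onto, so some [y] has [y x = 1];
    then [(x y - 1) x = 0], and injectivity makes [y] a two-sided inverse. *)
Lemma galg_unitP x : (forall y, y * x = 0 -> y = 0) -> x \is a GRing.unit.
Proof.
move=> inj; have ker : lker (amulr x) == 0%VS.
  by apply/lker0P=> u v; rewrite !lfunE /= => /eqP;
    rewrite -subr_eq0 -mulrBl => /eqP/inj/eqP; rewrite subr_eq0 => /eqP.
have [y] : exists y, y * x = 1.
  have : 1 \in limg (amulr x).
    suff -> : limg (amulr x) = fullv by rewrite memvf.
    by apply/eqP; rewrite eqEdim subvf limg_dim_eq ?leqnn // (eqP ker) capv0.
  by case/memv_imgP=> y _ ->; exists y; rewrite lfunE.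
move=> yx; apply/unitrP; exists y; split=> //.
by apply/eqP; rewrite -subr_eq0; apply/eqP/inj; rewrite mulrBl -mulrA yx mulr1 mul1r subrr.
Qed.

End Coefficients.

(** * The support of the R-matrix *)

Section RMatrixSupport.
Variables (k : fieldType) (G : finGroupType) (F : galg k (prodG G G)).
Hypotheses (tF : is_twist F) (iF : is_invariant F).
Local Notation R := (rmat F).

Let uF : F \is a GRing.unit. Proof. by case: tF. Qed.

Lemma rmat_flip : rmat (flip F) = flip R.
Proof.
by rewrite /rmat flipK flipM flipK (morph_unitV (@flip1 k G) (@flipM k G) uF).
Qed.

Lemma rmat_flipM : flip R * R = 1.
Proof. by rewrite -rmat_flip /rmat flipK mulrA divrK ?flip_unit // divrr. Qed.

Lemma rmat_invariant : is_invariant R.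
Proof.
have iV : is_invariant F^-1 by move=> a; apply: commrV; exact: iF.
by move=> a; rewrite mulrA (flip_invariant iF) -mulrA iV mulrA.
Qed.

Lemma invariant_conj (X : galg k (prodG G G)) g h u : is_invariant X ->
  X ((g ^ u)%g, (h ^ u)%g) = X (g, h).
Proof.
move=> iX; have /ffunP/(_ ((g * u)%g, (h * u)%g)) := iX (gelt k u).
rewrite coprod_gelt tens_gelt.
rewrite (gelt_mulE (G := prodG G G)) (mul_geltE (G := prodG G G)).
rewrite [X in X = _ -> _](_ : _ = X ((u^-1 * (g * u))%g, (u^-1 * (h * u))%g)) // => E.
rewrite !conjgE E.
by rewrite -{2}(mulgK u g) -{2}(mulgK u h).
Qed.

(* Orthogonal idempotents are linearly independent, so the nonzero columns of
   [R] have a dual basis: every group element of the right support is a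
   combination of the rows of [R], and these commute. *)
Lemma gelt_slices g h : R (g, h) != 0 :> k ->
  exists f : G -> k, gelt k h = \sum_u f u *: slice R u.
Proof.
move=> Rgh; pose c v := slice (flip R) v.
have cE u v : c u * c v = (u == v)%:R *: c u.
  rewrite /c -rmat_flip rmat_slices //; first exact: flip_twist.
  exact: flip_invariant.
have ch : c h g = R (g, h) by rewrite /c slice_coef flipE.
(* The coefficient of [c v * c h] at [g] is the sum over [u] of [R (u, v)] times
   [(gelt k u * c h) g]. By orthogonality it is [R (g, h)] if [v = h] and 0 otherwise; dividing by
   [R (g, h)] gives the weights. *)
exists (fun u => (gelt k u * c h) g / R (g, h)); apply/ffunP=> v.
have := congr1 (fun x : galg k G => (x g : k) / R (g, h)) (cE v h).
rewrite {1}(galg_sumE (c v)) mulr_suml !sum_ffunE mulr_suml => E.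
apply: (etrans _ (etrans (esym E) _)).
  rewrite ffunE [X in _ = X / _]ffunE.
  case: eqVneq => [->|nvh]; last by rewrite /GRing.scale /= !mul0r.
  by rewrite ch /GRing.scale /= mul1r divff.
apply: eq_bigr => u _; rewrite -scalerAl ffunE [RHS]ffunE slice_coef /c slice_coef flipE.
by rewrite /GRing.scale /= -mulrA mulrC.
Qed.

Lemma rmat_support_commute g h g' h' :
  R (g, h) != 0 :> k -> R (g', h') != 0 :> k -> commute h h'.
Proof.
move=> /gelt_slices[f Ef] /gelt_slices[f' Ef']; apply: (@gelt_inj k).
rewrite !geltM Ef Ef' mulr_suml mulr_sumr; under eq_bigr do rewrite mulr_sumr.
under [RHS]eq_bigr do rewrite mulr_suml.
apply: eq_bigr => u _; apply: eq_bigr => v _.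
rewrite -!(scalerAl, scalerAr) !rmat_slices // scalerA [in RHS]scalerA mulrC.
by case: (eqVneq u v) => [->|nuv] //; rewrite !scale0r.
Qed.

Lemma rmat_support_right (A : {group G}) :
    (forall B : {group G}, B <| [set: G] -> abelian B -> B \subset A)%g ->
  forall g h, R (g, h) != 0 :> k -> h \in A.
Proof.
move=> maxA g h Rgh; pose S := [set v | [exists u, R (u, v) != 0 :> k]].
have Sh : h \in S by rewrite inE; apply/existsP; exists g.
suff /subsetP-> : <<S>>%g \subset A => //; first exact: mem_gen.
apply: maxA.
  rewrite /normal subsetT /= norms_gen //.
  apply/subsetP=> u _; rewrite inE; apply/subsetP=> _ /imsetP[v + ->].
  rewrite !inE => /existsP[w Rwv]; apply/existsP; exists (w ^ u)%g.
  by rewrite invariant_conj //; exact: rmat_invariant.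
rewrite abelian_gen; apply/centsP=> u + v.
rewrite !inE => /existsP[u' Ru] /existsP[v' Rv].
exact: rmat_support_commute Ru Rv.
Qed.

End RMatrixSupport.

Lemma rmat_support (k : fieldType) (G : finGroupType) (F : galg k (prodG G G))
    (A : {group G}) :
    is_twist F -> is_invariant F ->
    (forall B : {group G}, B <| [set: G] -> abelian B -> B \subset A)%g ->
  forall g h, rmat F (g, h) != 0 :> k -> (g \in A) && (h \in A).
Proof.
move=> tF iF maxA g h Rgh; rewrite (rmat_support_right tF iF maxA Rgh) andbT.
apply: (rmat_support_right (flip_twist tF) (flip_invariant iF) maxA (g := h)).
by rewrite rmat_flip // flipE.
Qed.

(** * Symmetric invariant twists *)

Section SymmetricTwists.
Variables (k : closedFieldType) (G : finGroupType) (F : galg k (prodG G G)).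
Hypotheses (tF : is_twist F) (iF : is_invariant F) (symF : flip F = F).
Local Notation kG := (galg k G).
Local Notation G3 := (prodG (prodG G G) G).

Let uF : F \is a GRing.unit. Proof. by case: tF. Qed.

(** On the dual of k[G], with the product of functionals [p] and [q] given by
    [x |-> (p (x) q)(Delta(x) F)], [T g] is the transpose of multiplication by the coordinate at
    [g]. *)
Let T g (x : kG) : kG := slice (coprod x * F) g.

Fact sym_op_linear g : linear (T g).
Proof. by move=> a x y; rewrite /T linearP mulrDl -scalerAl; exact: (linearP (slicel g)). Qed.
HB.instance Definition _ g := GRing.isLinear.Build k kG kG _ (T g) (sym_op_linear g).

(** The rows of [Y] are the iterated operators. The twist equation and invariance rewrite [Y] as
    [(Delta (x) id)(Delta(x) F)] times [F_12], which the exchange [pi] of the first two legs fixes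
    because [F] is symmetric. *)
Lemma sym_opC g g' x : T g (T g' x) = T g' (T g x).
Proof.
pose Y := coprod_r (coprod x * F) * one_l F.
have YE : Y = \sum_(p : prodG G G) tens (gelt k p) (T p.2 (T p.1 x)).
  rewrite /Y {1}(slice_sum (coprod x * F)) linear_sum mulr_suml.
  rewrite [RHS](eq_bigr (fun p : G * G => tens (gelt k (p : prodG G G)) (T p.2 (T p.1 x)))) //.
  rewrite -(pair_bigA _ (fun g g' => tens (gelt k ((g, g') : prodG G G)) (T g' (T g x)))) /=.
  apply: eq_bigr => u _; rewrite coprod_r_tens /one_l -galgA_multiplicative tensM mulr1.
  rewrite [X in tens _ X]slice_sum linear_sum /= [LHS](linear_sum (@galgA k G G G)).
  by apply: eq_bigr => v _; rewrite /= galgA_tens tens_gelt.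
have Yl : Y = leg (fun g h => (g, g, h)) (coprod x * F) * leg (fun g h => (g, h, 1%g)) F.
  have [_ E] := tF.
  rewrite -one_r_leg -coprod_l_leg /Y coprod_lM coprod_rM -!mulrA.
  by rewrite -one_l_coprod_r // -E one_r_coprod_l // coprod_coassoc.
pose pi (p : G3) : G3 := (p.1.2, p.1.1, p.2).
have piM : {morph @galg_map k G3 G3 pi : x y / x * y}.
  by apply: (@galg_mapM k G3 G3) => -[[? ?] ?] -[[? ?] ?].
have Ypi : galg_map pi Y = Y.
  rewrite Yl piM !leg_map /=; congr (_ * _).
  by rewrite -[in RHS]symF leg_flip.
apply/ffunP=> h; have := congr1 (fun Z : galg k G3 => Z (g, g', h)) Ypi.
rewrite -{1}[(g, g', h)]/(pi (g', g, h)) galg_map_inj;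
  last by move=> -[[? ?] ?] -[[? ?] ?] [-> -> ->].
rewrite -!(slice_coef (G := prodG G G) (H := G) Y) YE.
by rewrite (sliceE (G := prodG G G) _ (g', g)) (sliceE (G := prodG G G) _ (g, g')).
Qed.

Lemma symmetric_twist_grouplike :
  exists2 a : kG, a \is a GRing.unit & coprod a * F = tens a a.
Proof.
have [||a _ [a0 eiga]] := @common_eigenvector k kG G (fun g => linfun (T g)) fullv _ _ (fun=>
  subvf _).
- by move=> g g' v; rewrite !lfunE; exact: sym_opC.
- apply: contraNneq (oner_neq0 kG) => K0; apply/eqP.
  by apply/eqP; rewrite -memv0 -K0 memvf.
have [h ah] := galg_neq0 a0.
have [l lE] : exists l : G -> k, forall u v, (coprod a * F) (u, v) = l u * a v.
  have /choice[l lE] : forall u, exists b, T u a = b *: a.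
    by move=> u; have [b] := eiga u; rewrite lfunE => E; exists b.
  exists l => u v; rewrite -slice_coef -[slice _ u]/(T u a) lE ffunE.
  by [].
(* The entries of [coprod a * F] are [l u * a v], and this tensor is symmetric, so [l] is
   proportional to [a]; the factor is read off at [h]. *)
pose c := l h / a h.
have lc u : l u = c * a u.
  apply: (mulIf ah); rewrite -lE -flipE flipM flip_coprod symF lE /c.
  by rewrite mulrAC divfK.
have aaE : coprod a * F = c *: tens a a.
  by apply/ffunP=> -[u v]; rewrite lE lc !ffunE /= /GRing.scale /= mulrA.
have c0 : c != 0.
  apply: contraNneq ah => c0.
  have : coprod a = 0 by apply: (mulIr uF); rewrite aaE c0 scale0r mul0r.
  by rewrite -coprod_diag => ->; rewrite ffunE.
have caE : coprod (c *: a) * F = tens (c *: a) (c *: a).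
  by rewrite linearZ -scalerAl aaE tensZl tensZr.
(* If [x] kills [c *: a] then [(x (x) 1) Delta(c a)] vanishes, and its coefficient at [(g h, h)] is
   [x g] times the nonzero scalar [c * a h]. *)
exists (c *: a) => //; apply: galg_unitP => x xa0.
have : tens x (1 : kG) * coprod (c *: a) = 0.
  by apply: (mulIr uF); rewrite -mulrA caE tensM xa0 mul0r -(scale0r 0) tensZl scale0r.
move=> /ffunP E; apply/ffunP=> g; have /eqP := E ((g * h)%g, h).
rewrite tens_mul_coprodE mulgK [a in _ == a]ffunE mulf_eq0 => /orP[/eqP-> |].
  by rewrite ffunE.
by rewrite ffunE mulf_eq0 (negPf c0) (negPf ah).
Qed.
End SymmetricTwists.

(** Since [coprod x] is supported on the diagonal, comparing coefficients at [(g, h)] with [x g]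
    nonzero forces [x h] to be 1 for [h = g] and 0 otherwise. *)
Lemma grouplike_gelt (k : fieldType) (G : finGroupType) (x : galg k G) :
  x != 0 -> coprod x = tens x x -> exists g, x = gelt k g.
Proof.
move=> /galg_neq0[g xg] cx.
have E h : (g == h)%:R * x h = x g * x h.
  have := tens_mul_coprodE 1 x g h; rewrite tens11 mul1r cx !ffunE /= => ->.
  by rewrite eq_mulgV1.
exists g; apply/ffunP=> h; rewrite ffunE; apply: (mulfI xg); rewrite -E eq_sym.
by case: eqP => [->|_]; rewrite ?mul0r ?mulr0 // mulr1 mul1r.
Qed.

Lemma symmetric_itwist_delta1 (k : closedFieldType) (G : finGroupType)
    (F : itwist k G) :
  Int_k k G = Inn G -> flip (uval F) = uval F -> exists z, F = delta1 z.
Proof.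
move=> hInt symF; have /itwistP[tF iF] := valP F.
have [a ua aF] := symmetric_twist_grouplike tF iF symF.
have ut : tens a a \is a GRing.unit by apply: tens_unit.
(* As [a (x) a = Delta(a) F] and [F] commutes with [Delta(g)], the conjugate of [g] by [a] is
   grouplike. *)
have glike g : exists h, a * gelt k g * a^-1 = gelt k h.
  set y := _ * a^-1.
  have ya : y * a = a * gelt k g by rewrite /y divrK.
  apply: grouplike_gelt.
    have uy : y \is a GRing.unit by rewrite /y unitrMl ?unitrV // unitrMl ?gelt_unit.
    by apply: contraTneq uy => ->; rewrite unitr0.
  apply: (mulIr ut).
  by rewrite tensM ya -tensM -coprod_gelt -aF -[RHS]mulrA -iF !mulrA -!coprodM ya.
have [s sE] := choice glike.
have s_inj : injective s.
  move=> g h E; apply: (@gelt_inj k); apply: (mulrI ua).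
  apply: (mulIr (x := a^-1)); first by rewrite unitrV.
  by rewrite !sE E.
have sM g h : s (g * h)%g = (s g * s h)%g.
  apply: (@gelt_inj k); rewrite geltM -!sE geltM !mulrA divrK //.
have : perm s_inj \in Int_k k G.
  rewrite !inE; apply/andP; split.
    apply/andP; split; first by apply/subsetP=> x; rewrite !inE.
    by apply/morphicP=> x y _ _; rewrite !permE.
  apply/asboolP; exists (Units ua) => [x|g] /=; last by rewrite permE sE.
  split=> -[g ->]; last by exists (s g).
  by exists ((perm s_inj)^-1 g)%g; rewrite sE -(permE s_inj) permKV.
rewrite hInt => /imsetP[u _ su].
have suE g : s g = (g ^ u)%g.
  by rewrite -(permE s_inj) su; apply: conj_autE; rewrite inE.
(* Conjugation by [a] is [g |-> u^-1 g u], so multiplying [a] by [u] on the left makes it central;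
   the grouplike equation is kept. *)
pose z := gelt k u * a.
have uz : z \is a GRing.unit by rewrite unitrMl ?gelt_unit.
have zC b : z * b = b * z.
  rewrite (galg_sumE b) mulr_sumr mulr_suml; apply: eq_bigr => g _.
  rewrite -scalerAr -scalerAl; congr (_ *: _).
  have ag : a * gelt k g = gelt k (g ^ u)%g * a by rewrite -suE -sE divrK.
  by rewrite /z -mulrA ag !mulrA -!geltM conjgE mulKVg.
have zP : Units uz \in @central_unit_pred k G by apply/central_unitP.
exists (CentralUnit zP); apply: itwist_inj; rewrite uval_delta1 /=.
have -> : tens z z = coprod z * uval F.
  by rewrite coprodM -mulrA aF coprod_gelt tensM.
by rewrite iF -mulrA -coprodM mulrV // coprod1 mulr1.
Qed.

(** * Finiteness of the group of characters *)

Lemma units_expg_val (R : unitRingType) (x : units R) n : uval (x ^+ n)%g = uval x ^+ n.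
Proof. by elim: n => // n IH; rewrite expgS exprS val_unitsM IH. Qed.

(** A finite list containing all values of the characters of [A]; it makes [charg k A] a finite
    type, over which sums can be taken. *)
Lemma unity_roots_seq (k : closedFieldType) n : (0 < n)%N ->
  {s : seq (units k) | forall u, (u ^+ n = 1)%g -> u \in s}.
Proof.
move=> n_gt0; have [r rE] := closed_field_poly_normal ('X^n - 1 : {poly k}).
exists (pmap insub r) => u /(congr1 (@uval k)); rewrite units_expg_val => un.
rewrite mem_pmap_sub /=; have : root ('X^n - 1) (uval u).
  by rewrite rootE !hornerE un subrr.
by rewrite rE (monicP (monicXnsubC _ n_gt0)) scale1r root_prod_XsubC.
Qed.

Section CharacterFiniteness.
Variables (k : closedFieldType) (gT : finGroupType) (A : {group gT}).
Local Notation Ah := (charg k A).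
Implicit Types chi psi : Ah.

Lemma chargM chi : {morph charg_val chi : x y / (x * y)%g}.
Proof. by have /charg_predP := valP chi. Qed.

Lemma charg1 chi : charg_val chi 1%g = 1%g.
Proof. by apply: (mulgI (charg_val chi 1%g)); rewrite -chargM !mulg1. Qed.

Lemma charg_expg_card chi a : (charg_val chi a ^+ #|A| = 1)%g.
Proof.
have X n : charg_val chi (a ^+ n)%g = (charg_val chi a ^+ n)%g.
  by elim: n => [|n IH]; rewrite ?charg1 // !expgS chargM IH.
rewrite -X (_ : (a ^+ #|A|)%g = 1%g) ?charg1 //; apply: val_inj => /=.
by rewrite -(expg_cardG (valP a)); elim: #|A| => // n IH; rewrite !expgS /= IH.
Qed.

Let s := sval (unity_roots_seq k (cardG_gt0 A)).

Definition charg_encode chi : {ffun subg_of A -> seq_sub s} :=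
  [ffun a => SeqSub (svalP (unity_roots_seq k (cardG_gt0 A)) _ (charg_expg_card chi a))].
Definition charg_decode (f : {ffun subg_of A -> seq_sub s}) : option Ah :=
  insub [ffun a => ssval (f a)].

Fact charg_encodeK : pcancel charg_encode charg_decode.
Proof.
move=> chi; rewrite /charg_decode (_ : [ffun _ => _] = charg_val chi) ?valK //.
by apply/ffunP=> a; rewrite !ffunE.
Qed.

HB.instance Definition _ : isCountable Ah := PCanIsCountable charg_encodeK.
HB.instance Definition _ : isFinite Ah := PCanIsFinite charg_encodeK.

Lemma chargC chi psi : (chi * psi = psi * chi)%g.
Proof.
apply: val_inj; apply/ffunP=> a.
by rewrite ![(_ * _)%g]/((_ * _)%g) /= !ffunE unitsC.
Qed.

End CharacterFiniteness.

(** * Values of characters *)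

Section Evaluation.
Variables (k : fieldType) (gT : finGroupType) (A : {group gT}).
Implicit Types chi psi : charg k A.

(** Outside [A], [subg A g] is the neutral element, so the value there is the default 1. *)
Definition chev chi (g : gT) : k := uval (charg_val chi (subg A g)).

Lemma chev_neq0 chi g : chev chi g != 0.
Proof. exact: uval_neq0. Qed.

Lemma chevMg chi : {in A &, {morph chev chi : g h / (g * h)%g >-> g * h}}.
Proof.
move=> g h gA hA; rewrite /chev -val_unitsM; have /charg_predP <- := valP chi.
by congr (uval (charg_val chi _)); apply: val_inj; rewrite /= !subgK ?groupM.
Qed.

Lemma chevM chi psi g : chev (chi * psi)%g g = chev chi g * chev psi g.
Proof. by rewrite /chev [(chi * psi)%g]/((_ * _)%g) /= ffunE. Qed.

Lemma chev1 g : chev 1%g g = 1.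
Proof. by rewrite /chev [1%g]/1%g /= ffunE. Qed.

Lemma chev1g chi : chev chi 1%g = 1.
Proof. by apply: (mulIf (chev_neq0 chi 1%g)); rewrite -chevMg ?group1 // mulg1 mul1r. Qed.

Lemma chevV chi g : g \in A -> chev chi (g^-1)%g = (chev chi g)^-1.
Proof.
move=> gA; apply: (mulfI (chev_neq0 chi g)).
by rewrite -chevMg ?groupV // mulgV chev1g divff ?chev_neq0.
Qed.

Lemma chev_inj chi psi : {in A, chev chi =1 chev psi} -> chi = psi.
Proof.
move=> E; apply: val_inj; apply/ffunP=> a; apply: units_inj.
by have := E (sgval a) (valP a); rewrite /chev sgvalK.
Qed.

End Evaluation.

(** * Fourier analysis on [A] *)

Section Fourier.
Variables (k : closedFieldType) (hk : [pchar k] =i pred0).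
Variables (G : finGroupType) (A : {group G}) (abA : abelian A).
Local Notation kG := (galg k G).
Local Notation Ah := (charg k A).
Local Notation kG2 := (galg k (prodG G G)).
Local Notation kG3 := (galg k (prodG (prodG G G) G)).
Implicit Types chi psi phi : Ah.

Let n_neq0 m : (0 < m)%N -> m%:R != 0 :> k.
Proof. by move=> m0; rewrite (proj1 (pcharf0P k) hk) -lt0n. Qed.

(* A common eigenvector of [A] in the image of [a - 1] affords [chi]. *)
Lemma charg_separates (a : G) : a \in A -> a != 1%g -> exists chi, chev chi a != 1.
Proof.
move=> aA a1; pose U := limg (amull (gelt k a - 1)).
pose f (b : subg_of A) := amull (gelt k (sgval b)).
have aC (b c : G) : b \in A -> c \in A -> gelt k b * gelt k c = gelt k c * gelt k b.
  by move=> bA cA; rewrite -!geltM (centsP abA b bA c cA).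
have [|||v vU [v0 eigv]] := @common_eigenvector k kG _ f U.
- move=> b c x; rewrite /f !lfunE /= !mulrA; congr (_ * _).
  by apply: aC; apply: valP.
- apply: contraNneq a1 => U0; apply/eqP/(@gelt_inj k); apply/eqP.
  rewrite gelt1 -subr_eq0 -memv0 -U0; apply/memv_imgP; exists 1; rewrite ?memvf //.
  by rewrite lfunE /= mulr1.
- move=> b; apply/subvP=> _ /memv_imgP[_ /memv_imgP[w _ ->] ->].
  apply/memv_imgP; exists (gelt k (sgval b) * w); rewrite ?memvf //.
  rewrite !lfunE /= !mulrA; congr (_ * _).
  by rewrite mulrBr mulrBl mulr1 mul1r aC ?subgP.
have /choice[l lE] : forall b : subg_of A, exists u : units k, gelt k (sgval b) * v =
  uval u *: v.
  move=> b; have [c] := eigv b; rewrite lfunE /= => cE.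
  have uc : c \is a GRing.unit.
    rewrite unitfE; apply: contraNneq v0 => c0; apply/eqP.
    by apply: (mulrI (gelt_unit k (sgval b))); rewrite cE c0 scale0r mulr0.
  by exists (Units uc).
have lP : [ffun b => l b] \in @charg_pred k G A.
  apply/charg_predP=> b c; rewrite !ffunE; apply: units_inj.
  have /eqP : uval (l (b * c)%g) *: v = (uval (l b) * uval (l c)) *: v.
    by rewrite -lE geltM -mulrA lE -scalerAr lE scalerA mulrC.
  by rewrite -subr_eq0 -scalerBl scaler_eq0 (negPf v0) orbF subr_eq0 => /eqP.
exists (Charg lP); rewrite /chev /= ffunE; apply: contraNneq v0 => l1.
have /memv_imgP[w _] := vU; rewrite lfunE /= => vE.
have av : gelt k a * v = v by have := lE (subg A a); rewrite l1 subgK // scale1r.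
(* If the character were 1 at [a], then [a v = v] with [v = (a - 1) w], so each factor [a] would add
   one [v] to [w]; at the order of [a] a nonzero multiple of [v] would vanish. *)
have aw i : gelt k (a ^+ i)%g * w = w + v *+ i.
  elim: i => [|i IH]; first by rewrite mul1r addr0.
  rewrite expgS geltM -mulrA IH mulrDr mulrnAr av mulrS addrA; congr (_ + _).
  by rewrite vE mulrBl mul1r addrC subrK.
have := aw #[a]%g; rewrite expg_order mul1r => /eqP.
rewrite -{1}[w]addr0 (inj_eq (addrI w)) eq_sym -scaler_nat scaler_eq0.
by rewrite (negPf (n_neq0 (order_gt0 a))) orFb.
Qed.

Local Notation n := (#|A|%:R : k).
Let n0 : n != 0. Proof. exact/n_neq0/cardG_gt0. Qed.

Lemma sum_chev chi : \sum_(a in A) chev chi a = n * (chi == 1%g)%:R.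
Proof.
case: eqVneq => [->|chi1].
  by under eq_bigr do rewrite chev1; rewrite sumr_const mulr1.
have [b bA chib] : exists2 b, b \in A & chev chi b != 1.
  apply: contrapT => H; move/eqP: chi1; apply; apply: chev_inj => b bA; rewrite chev1.
  by apply/eqP; apply: contrapT => /negP ?; apply: H; exists b.
have E : \sum_(a in A) chev chi a = chev chi b * \sum_(a in A) chev chi a.
  rewrite mulr_sumr (reindex_inj (mulgI b)) /=.
  by apply: eq_big => a; [rewrite groupMl | rewrite groupMl // => aA; rewrite chevMg].
apply/eqP; rewrite mulr0; move/eqP: E; rewrite -subr_eq0 -{1}[\sum_(_ in _) _]mul1r -mulrBl
  mulf_eq0.
by rewrite subr_eq0 eq_sym (negPf chib).
Qed.

Lemma sum_charg a : a \in A -> \sum_(chi : Ah) chev chi a = n * (a == 1%g)%:R.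
Proof.
have off b : b \in A -> b != 1%g -> \sum_(chi : Ah) chev chi b = 0.
  move=> bA b1; have [chi chib] := charg_separates bA b1.
  have E : \sum_(psi : Ah) chev psi b = chev chi b * \sum_(psi : Ah) chev psi b.
    rewrite mulr_sumr (reindex_inj (mulgI chi)) /=.
    by apply: eq_bigr => psi _; rewrite chevM.
  apply/eqP; move/eqP: E; rewrite -subr_eq0 -{1}[\sum_(psi : Ah) _]mul1r -mulrBl mulf_eq0.
  by rewrite subr_eq0 eq_sym (negPf chib).
move=> aA; case: eqVneq => [->|a1]; last by rewrite mulr0 off.
(* Summing in both orders counts the characters: in one only [b = 1] contributes, in the other only
   the trivial character, with total [#|A|]. *)
have : \sum_(b in A) \sum_(chi : Ah) chev chi b = \sum_(chi : Ah) chev chi 1%g.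
  by rewrite (bigD1 1%g) ?group1 //= [X in _ + X]big1 ?addr0 // => b /andP[bA b1]; apply: off.
rewrite exchange_big /= (eq_bigr _ (fun chi _ => sum_chev chi)) => <-.
rewrite (bigD1 1%g) //= eqxx big1 ?addr0 // => chi /negPf->.
by rewrite mulr0.
Qed.

Definition char_idem chi : kG := \sum_(a in A) (n^-1 * chev chi (a^-1)%g) *: gelt k a.

Lemma gelt_char_idem chi b : b \in A -> gelt k b * char_idem chi = chev chi b *: char_idem chi.
Proof.
move=> bA; rewrite /char_idem mulr_sumr scaler_sumr [RHS](reindex_inj (mulgI b)) /=.
apply: eq_big => a; first by rewrite groupMl.
move=> aA; rewrite -scalerAr -geltM scalerA invgM chevMg ?groupV // (chevV _ bA).
congr (_ *: _); field.
by rewrite chev_neq0 n0.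
Qed.

Lemma chev_orth psi chi :
  \sum_(a in A) n^-1 * chev psi (a^-1)%g * chev chi a = (psi == chi)%:R.
Proof.
transitivity (n^-1 * \sum_(a in A) chev (psi^-1 * chi)%g a).
  rewrite mulr_sumr; apply: eq_bigr => a aA; rewrite chevM chevV // mulrA.
  congr (_ * _ * _); apply: (mulfI (chev_neq0 psi a)).
  by rewrite divff ?chev_neq0 // -chevM mulgV chev1.
rewrite sum_chev mulrA mulVf // mul1r; congr ((nat_of_bool _)%:R).
apply/eqP/eqP => [E|->]; last by rewrite mulVg.
by rewrite -[chi](mulKVg psi) E mulg1.
Qed.

Lemma char_idemM psi chi : char_idem psi * char_idem chi = (psi == chi)%:R *: char_idem chi.
Proof.
rewrite {1}/char_idem mulr_suml -chev_orth scaler_suml; apply: eq_bigr => a aA.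
by rewrite -scalerAl gelt_char_idem // scalerA.
Qed.

Lemma sum_char_idem : \sum_chi char_idem chi = 1.
Proof.
rewrite /char_idem exchange_big /= (bigD1 1%g) ?group1 //= [X in _ + X]big1 =>
  [|a /andP[aA a1]].
  rewrite -scaler_suml -mulr_sumr sum_charg ?groupV ?group1 // invg1 eqxx mulr1 mulVf //.
  by rewrite scale1r addr0.
rewrite -scaler_suml -mulr_sumr sum_charg ?groupV // invg_eq1 (negPf a1).
by rewrite !mulr0 scale0r.
Qed.

Lemma char_idem_neq0 chi : char_idem chi != 0.
Proof.
apply: contraTneq (oner_neq0 k) => /(congr1 (fun x : kG => (x 1%g : k))).
rewrite /char_idem sum_ffunE (bigD1 1%g) ?group1 //= [X in _ + X]big1 => [|a /andP[_ a1]].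
  rewrite !ffunE eqxx invg1 chev1g !mulr1 addr0 => /eqP.
  by rewrite /GRing.scale /= !mulr1 invr_eq0 (negPf n0).
by rewrite !ffunE eq_sym (negPf a1); exact: mulr0.
Qed.

Lemma char_idem_conj (nA : (A <| [set: G])%g) g chi :
  gelt k g * char_idem chi = char_idem (charg_conj nA g chi) * gelt k g.
Proof.
have memJ (b : G) : ((b ^ g)%g \in A) = (b \in A).
  by apply: memJ_norm; have /andP[_ /subsetP] := nA; apply; rewrite inE.
rewrite /char_idem mulr_sumr mulr_suml (reindex_inj (conjg_inj g)) /=.
apply: eq_big => b //; rewrite memJ => bA.
rewrite -scalerAr -scalerAl -!geltM conjgE mulKVg; congr ((_ * _) *: _).
rewrite /chev /= ffunE; congr (uval (charg_val chi (subg A _))).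
by rewrite subgK ?groupV // conjVg conjgE.
Qed.

Definition char_idem2 chi psi : kG2 := tens (char_idem chi) (char_idem psi).

Lemma sum_char_idem2 : \sum_chi \sum_psi char_idem2 chi psi = 1.
Proof.
rewrite -tens11 -sum_char_idem tens_suml; apply: eq_bigr => chi _.
by rewrite linear_sum.
Qed.

Lemma tens_neq0 (H K : finGroupType) (x : galg k H) (y : galg k K) :
  x != 0 -> y != 0 -> tens x y != 0.
Proof.
move=> /galg_neq0[g xg] /galg_neq0[h yh]; apply: contraTneq (mulf_neq0 xg yh).
by move=> /ffunP/(_ (g, h)); rewrite !ffunE /= negbK => ->.
Qed.

Lemma char_idem2_neq0 chi psi : char_idem2 chi psi != 0.
Proof. by apply: tens_neq0; apply: char_idem_neq0. Qed.

Lemma char_idem2M chi psi chi' psi' : char_idem2 chi psi * char_idem2 chi' psi' =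
  ((chi == chi') && (psi == psi'))%:R *: char_idem2 chi' psi'.
Proof. by rewrite tensM !char_idemM tensZl tensZr scalerA -natrM mulnb. Qed.

(** The idempotents sum to 1, so they also detect elements of k[G] (x) k[G] that lie outside k[A]
    (x) k[A]. *)
Lemma eq_on_char_idem2 (X Y : kG2) :
  (forall chi psi, X * char_idem2 chi psi = Y * char_idem2 chi psi) -> X = Y.
Proof.
move=> E; rewrite -[X]mulr1 -[Y]mulr1 -sum_char_idem2 !mulr_sumr; apply: eq_bigr => chi _.
by rewrite !mulr_sumr; apply: eq_bigr => psi _.
Qed.

Lemma eq_on_char_idem3 (X Y : kG3) :
  (forall chi psi phi, X * tens (char_idem2 chi psi) (char_idem phi) =
    Y * tens (char_idem2 chi psi) (char_idem phi)) -> X = Y.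
Proof.
move=> E; have S : \sum_chi \sum_psi \sum_phi tens (char_idem2 chi psi) (char_idem phi) =
  1 :> kG3.
  rewrite -tens11 -sum_char_idem2 tens_suml; apply: eq_bigr => chi _.
  rewrite tens_suml; apply: eq_bigr => psi _.
  by rewrite -sum_char_idem linear_sum.
rewrite -[X]mulr1 -[Y]mulr1 -S !mulr_sumr; apply: eq_bigr => chi _.
by rewrite !mulr_sumr; apply: eq_bigr => psi _; rewrite !mulr_sumr; apply: eq_bigr.
Qed.

(* The element of [k[A] (x) k[A]] whose Fourier transform is [c]. *)
Definition char_twist (c : Ah -> Ah -> k) : kG2 :=
  \sum_chi \sum_psi c chi psi *: char_idem2 chi psi.

Lemma char_twist_idem2 c chi psi : char_twist c * char_idem2 chi psi =
  c chi psi *: char_idem2 chi psi.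
Proof.
rewrite /char_twist mulr_suml (bigD1 chi) //= mulr_suml (bigD1 psi) //=
  -scalerAl char_idem2M !eqxx scale1r.
rewrite [X in _ + X + _]big1 ?addr0 => [|psi' /negPf npsi]; last first.
  by rewrite -scalerAl char_idem2M npsi andbF scale0r scaler0.
rewrite big1 ?addr0 // => chi' /negPf nchi; rewrite mulr_suml big1 // => psi' _.
by rewrite -scalerAl char_idem2M nchi scale0r scaler0.
Qed.

Lemma char_twist_inj c d : char_twist c = char_twist d -> forall chi psi, c chi psi = d chi psi.
Proof.
move=> E chi psi; apply/eqP; rewrite -subr_eq0.
have := char_twist_idem2 d chi psi; rewrite -E char_twist_idem2 => /eqP.
by rewrite -subr_eq0 -scalerBl scaler_eq0 (negPf (char_idem2_neq0 _ _)) orbF.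
Qed.

Lemma char_twist_mul c d : char_twist c * char_twist d = char_twist (fun chi psi =>
  c chi psi * d chi psi).
Proof.
apply: eq_on_char_idem2 => chi psi; rewrite -mulrA !char_twist_idem2 -scalerAr char_twist_idem2.
by rewrite scalerA mulrC.
Qed.

Lemma char_twist1 : char_twist (fun _ _ => 1) = 1.
Proof. by apply: eq_on_char_idem2 => chi psi; rewrite char_twist_idem2 scale1r mul1r. Qed.

Lemma flip_char_twist c : flip (char_twist c) = char_twist (fun chi psi => c psi chi).
Proof.
rewrite /char_twist linear_sum [RHS]exchange_big /=; apply: eq_bigr => chi _.
rewrite linear_sum; apply: eq_bigr => psi _.
by rewrite linearZ /= flip_tens.
Qed.

Lemma gelt2_char_idem2 a b chi psi : a \in A -> b \in A ->
  tens (gelt k a) (gelt k b) * char_idem2 chi psi =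
    (chev chi a * chev psi b) *: char_idem2 chi psi.
Proof. by move=> aA bA; rewrite tensM !gelt_char_idem // tensZl tensZr scalerA. Qed.

(** Under the Fourier transform the coproduct becomes the product of characters, because [a (x) a]
    acts on the idempotent of [chi] and [psi] by [chev (chi * psi) a]. *)
Lemma coprod_char_idem2 alpha chi psi :
  coprod (char_idem alpha) * char_idem2 chi psi =
  (alpha == (chi * psi)%g)%:R *: char_idem2 chi psi.
Proof.
rewrite {1}/char_idem linear_sum mulr_suml -chev_orth scaler_suml; apply: eq_bigr => a aA.
by rewrite linearZ /= -scalerAl coprod_gelt gelt2_char_idem2 // scalerA chevM.
Qed.

Lemma coprod_l_char_twist c chi psi phi :
  coprod_l (char_twist c) * tens (char_idem2 chi psi) (char_idem phi) =
  c (chi * psi)%g phi *: tens (char_idem2 chi psi) (char_idem phi).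
Proof.
rewrite /char_twist linear_sum mulr_suml (bigD1 (chi * psi)%g) //=
  linear_sum mulr_suml (bigD1 phi) //=.
have E alpha beta : coprod_l (c alpha beta *: char_idem2 alpha beta) *
      tens (char_idem2 chi psi) (char_idem phi) =
    (c alpha beta * ((alpha == (chi * psi)%g) && (beta == phi))%:R) *:
      tens (char_idem2 chi psi) (char_idem phi).
  rewrite linearZ_LR /= -scalerAl coprod_l_tens tensM coprod_char_idem2 char_idemM.
  by rewrite tensZl tensZr !scalerA -natrM mulnb.
rewrite E !eqxx mulr1 [X in _ + X + _]big1 ?addr0 => [|beta /negPf nb]; last first.
  by rewrite E nb andbF mulr0 scale0r.
rewrite [X in _ + X]big1 ?addr0 // => alpha /negPf na;
  rewrite linear_sum mulr_suml big1 // => beta _.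
by rewrite E na mulr0 scale0r.
Qed.

Lemma coprod_r_char_twist c chi psi phi :
  coprod_r (char_twist c) * tens (char_idem2 chi psi) (char_idem phi) =
  c chi (psi * phi)%g *: tens (char_idem2 chi psi) (char_idem phi).
Proof.
rewrite /char_twist linear_sum mulr_suml (bigD1 chi) //=
  linear_sum mulr_suml (bigD1 (psi * phi)%g) //=.
have E alpha beta : coprod_r (c alpha beta *: char_idem2 alpha beta) *
      tens (char_idem2 chi psi) (char_idem phi) =
    (c alpha beta * ((alpha == chi) && (beta == (psi * phi)%g))%:R) *:
      tens (char_idem2 chi psi) (char_idem phi).
  rewrite linearZ_LR /= -scalerAl coprod_r_tens -!galgA_tens -galgA_multiplicative tensM.
  rewrite coprod_char_idem2 char_idemM tensZl tensZr scalerA linearZ_LR /= scalerA.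
  by rewrite -natrM mulnb.
rewrite E !eqxx mulr1 [X in _ + X + _]big1 ?addr0 => [|beta /negPf nb]; last first.
  by rewrite E nb andbF mulr0 scale0r.
rewrite [X in _ + X]big1 ?addr0 // => alpha /negPf na;
  rewrite linear_sum mulr_suml big1 // => beta _.
by rewrite E na mulr0 scale0r.
Qed.

Lemma one_r_char_twist c chi psi phi :
  one_r (char_twist c) * tens (char_idem2 chi psi) (char_idem phi) =
  c chi psi *: tens (char_idem2 chi psi) (char_idem phi).
Proof. by rewrite tensM char_twist_idem2 mul1r tensZl. Qed.

Lemma one_l_char_twist c chi psi phi :
  one_l (char_twist c) * tens (char_idem2 chi psi) (char_idem phi) =
  c psi phi *: tens (char_idem2 chi psi) (char_idem phi).
Proof.
rewrite -galgA_tens /one_l -galgA_multiplicative tensM char_twist_idem2 mul1r.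
by rewrite tensZr linearZ_LR.
Qed.

Lemma char_twist_unit c : (forall chi psi, c chi psi != 0) -> char_twist c \is a GRing.unit.
Proof.
move=> c0; have cV : char_twist c * char_twist (fun chi psi => (c chi psi)^-1) = 1.
  by rewrite char_twist_mul -char_twist1; apply: eq_on_char_idem2 => chi psi;
    rewrite !char_twist_idem2 divff.
apply/unitrP; exists (char_twist (fun chi psi => (c chi psi)^-1)); split=> //.
by rewrite char_twist_mul -char_twist1; apply: eq_on_char_idem2 => chi psi;
  rewrite !char_twist_idem2 mulVf.
Qed.

(** On a triple tensor of idempotents the four factors of the twist equation act by the four scalars
    of the cocycle identity. *)
Lemma char_twist_is_twist c : (forall chi psi, c chi psi != 0) ->
    (forall x y z, c y z * c x (y * z)%g = c (x * y)%g z * c x y) ->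
  is_twist (char_twist c).
Proof.
move=> c0 cc; split; first exact: char_twist_unit.
apply: eq_on_char_idem3 => chi psi phi.
rewrite -!mulrA coprod_l_char_twist coprod_r_char_twist -!scalerAr one_r_char_twist
  one_l_char_twist !scalerA.
by rewrite -cc mulrC.
Qed.

Lemma gelt_diag_char_idem2 (nA : (A <| [set: G])%g) g chi psi :
  coprod (gelt k g) * char_idem2 chi psi =
  char_idem2 (charg_conj nA g chi) (charg_conj nA g psi) * coprod (gelt k g).
Proof. by rewrite coprod_gelt !tensM !(char_idem_conj nA). Qed.

Lemma char_twist_invariantP (nA : (A <| [set: G])%g) c :
  is_invariant (char_twist c) <->
  forall g chi psi, c (charg_conj nA g chi) (charg_conj nA g psi) = c chi psi.
Proof.
have L g chi psi : coprod (gelt k g) * char_twist c * char_idem2 chi psi =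
    c chi psi *: (coprod (gelt k g) * char_idem2 chi psi).
  by rewrite -mulrA char_twist_idem2 -scalerAr.
have M g chi psi : char_twist c * coprod (gelt k g) * char_idem2 chi psi =
    c (charg_conj nA g chi) (charg_conj nA g psi) *: (coprod (gelt k g) * char_idem2 chi psi).
  by rewrite -mulrA (gelt_diag_char_idem2 nA) mulrA char_twist_idem2 -scalerAl.
split=> [iF g chi psi|cE a].
  have /eqP := M g chi psi; rewrite -iF L -subr_eq0 -scalerBl scaler_eq0 subr_eq0.
  case/orP=> [/eqP-> //|]; rewrite coprod_gelt => /eqP X0.
  case/eqP: (char_idem2_neq0 chi psi).
  by apply: (mulrI (tens_unit (gelt_unit k g) (gelt_unit k g))); rewrite X0 mulr0.
rewrite (galg_sumE a) linear_sum mulr_suml mulr_sumr; apply: eq_bigr => g _.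
rewrite linearZ /= -scalerAl -scalerAr; congr (_ *: _).
by apply: eq_on_char_idem2 => chi psi; rewrite L M cE.
Qed.

Definition fourier1 psi (y : kG) : k := \sum_h y h * chev psi h.

Definition fourier2 (X : kG2) chi psi : k := \sum_g chev chi g * fourier1 psi (slice X g).

Lemma fourier1_char_idem psi (y : kG) : (forall h, y h != 0 :> k -> h \in A) ->
  y * char_idem psi = fourier1 psi y *: char_idem psi.
Proof.
move=> sy; rewrite {1}(galg_sumE y) mulr_suml scaler_suml; apply: eq_bigr => h _.
rewrite -scalerAl; have [-> | /sy hA] := eqVneq (y h : k) 0; first by rewrite mul0r !scale0r.
by rewrite gelt_char_idem // scalerA.
Qed.

Lemma fourier2K (X : kG2) : (forall g h, X (g, h) != 0 :> k -> (g \in A) && (h \in A)) ->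
  X = char_twist (fourier2 X).
Proof.
move=> sX; apply: eq_on_char_idem2 => chi psi; rewrite char_twist_idem2.
rewrite {1}(slice_sum X) mulr_suml scaler_suml; apply: eq_bigr => g _.
rewrite tensM [slice _ _ * _]fourier1_char_idem => [|h];
  last by rewrite slice_coef => /sX/andP[].
have [gA|ngA] := boolP (g \in A); first by rewrite gelt_char_idem // tensZl tensZr scalerA.
suff -> : fourier1 psi (slice X g) = 0 by rewrite mulr0 !scale0r linear0.
rewrite /fourier1 big1 // => h _; rewrite slice_coef.
by have [->|/sX] := eqVneq (X (g, h) : k) 0; rewrite ?mul0r // (negPf ngA).
Qed.

(** Evaluated at [phi], the rows of [rmat F] become orthogonal idempotents of [k], so only diagonal
    terms survive in a product of two values of the transform. Skewness comes from [rmat_flipM]. *)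
Lemma rmat_bicharacter (F : kG2) :
    is_twist F -> is_invariant F ->
    (forall B : {group G}, B <| [set: G] -> abelian B -> B \subset A)%g ->
  exists2 b : Ah -> Ah -> k, rmat F = char_twist b &
    (forall chi psi phi, b (chi * psi)%g phi = b chi phi * b psi phi) /\
    (forall chi psi, b chi psi * b psi chi = 1).
Proof.
move=> tF iF maxA; have sR := rmat_support tF iF maxA.
exists (fourier2 (rmat F)); first exact: fourier2K.
split=> [chi psi phi|chi psi]; last first.
  apply: (char_twist_inj (c := fun chi psi => fourier2 (rmat F) chi psi * fourier2 (rmat F)
    psi chi) (d := fun _ _ => 1)).
  have := rmat_flipM tF; rewrite {1 2}(fourier2K sR) flip_char_twist char_twist_mul
    char_twist1 => <-.
  by apply: eq_on_char_idem2 => *; rewrite !char_twist_idem2 mulrC.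
have sl g h : slice (rmat F) g h != 0 :> k -> h \in A.
  by rewrite slice_coef => /sR/andP[].
have E g g' : fourier1 phi (slice (rmat F) g) * fourier1 phi (slice (rmat F) g') =
    (g == g')%:R * fourier1 phi (slice (rmat F) g).
  apply/eqP; rewrite -subr_eq0.
  have : slice (rmat F) g * slice (rmat F) g' * char_idem phi =
      (g == g')%:R *: slice (rmat F) g * char_idem phi.
    by rewrite rmat_slices.
  rewrite -scalerAl -mulrA !fourier1_char_idem //; try exact: sl.
  rewrite -scalerAr fourier1_char_idem ?scalerA; last exact: sl.
  by move/eqP; rewrite -subr_eq0 -scalerBl scaler_eq0 (negPf (char_idem_neq0 _)) orbF mulrC.
rewrite /fourier2 big_distrlr /=; apply: eq_bigr => g _.
rewrite (bigD1 g) //= big1 ?addr0 => [|g' /negPf ng].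
  by rewrite mulrACA E eqxx mul1r chevM.
by rewrite mulrACA E eq_sym ng mul0r mulr0.
Qed.
End Fourier.

(** * Symmetric cocycles on a finite abelian group *)

Section SymmetricCocycle.
Variables (k : closedFieldType) (T : finGroupType) (c : cochain2 k T).
Hypotheses (TC : forall x y : T, (x * y = y * x)%g).
Hypotheses (cc : is_cocycle2 c) (cS : forall x y, c x y = c y x).
Local Notation V := {ffun T -> k^o}.

Let ccv x y z : uval (c y z) * uval (c x (y * z)%g) = uval (c (x * y)%g z) * uval (c x y).
Proof. by rewrite -!val_unitsM cc. Qed.

(** Translation weighted by [c]: by the cocycle identity [op y \o op x] is [c x y] times
    [op (x * y)], so the operators commute for symmetric [c] and abelian [T]. *)
Let op x (f : V) : V := [ffun y => (uval (c x y) * f (x * y)%g : k)].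

Fact symmetric_op_linear x : linear (op x).
Proof.
move=> a f g; apply/ffunP=> y; rewrite !ffunE mulrDr; congr (_ + _).
by rewrite /GRing.scale /= mulrCA.
Qed.
HB.instance Definition _ x := GRing.isLinear.Build k V V _ (op x) (symmetric_op_linear x).

(* A common eigenvector of the operators [op x] trivializes [c]. *)
Lemma symmetric_cocycle_cobound : exists f, c = cobound f.
Proof.
have [||f _ [f0 eigf]] := @common_eigenvector k V T (fun x => linfun (op x)) fullv _ _ (fun=>
  subvf _).
- move=> x y f; rewrite !lfunE /=; apply/ffunP=> z;
  rewrite !ffunE !mulrA (ccv y x z) (ccv x y z).
  by rewrite (TC y x) (cS y x) !mulgA (TC y x).
- apply/negP=> /eqP K0; case/eqP: (oner_neq0 k).
  have : ([ffun=> 1] : V) \in 0%VS by rewrite -K0 memvf.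
  by rewrite memv0 => /eqP/ffunP/(_ 1%g); rewrite !ffunE => ->.
have [y0 fy0] : exists y, f y != 0 :> k.
  apply/existsP; apply: contraNT f0 => /existsPn H; apply/eqP/ffunP=> y.
  by rewrite [RHS]ffunE; apply/eqP; rewrite -[_ == _]negbK H.
have /choice[l lE] : forall x, exists a : k, forall y, uval (c x y) * f (x * y)%g = a * f y.
  move=> x; have [a aE] := eigf x; exists a => y.
  by have /ffunP/(_ y) := aE; rewrite lfunE !ffunE.
have nz x : l x * f (x^-1 * y0)%g != 0.
  by rewrite -lE mulKVg mulf_neq0 ?uval_neq0.
have l0 x : l x \is a GRing.unit.
  by rewrite unitfE; apply: contraNneq (nz x) => ->; rewrite mul0r.
have f1 : f 1%g != 0 :> k.
  by apply: contraNneq (nz y0); rewrite mulVg => ->; rewrite mulr0.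
(* Cochains are not normalized, so the constant [c 1 1] enters when the eigenvector equation is
   evaluated at 1; this shows that [l] is proportional to [f]. *)
have cx1 x : uval (c x 1%g) = uval (c 1%g 1%g).
  by have := ccv x 1%g 1%g; rewrite !mulg1 => /(mulIf (uval_neq0 _)).
have lf x : l x = uval (c 1%g 1%g) / f 1%g * f x.
  by apply: (mulIf f1); rewrite -lE mulg1 cx1 mulrAC divfK.
exists (fun x => Units (l0 x)); apply: funext => x; apply: funext => y; apply: units_inj.
rewrite !(val_unitsM, val_unitsV) /=.
have lxy : l (x * y)%g != 0 by rewrite -unitfE.
have E : uval (c x y) * l (x * y)%g = l x * l y.
  by rewrite (lf (x * y)%g) mulrCA lE mulrCA -lf.
by apply: (mulIf lxy); rewrite E [RHS]mulrAC divfK // mulrC.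
Qed.

End SymmetricCocycle.

(** * The alternation of a 2-cocycle *)

Section Alternation.
Variables (k : fieldType) (T : groupType).
Hypothesis TC : forall x y : T, (x * y = y * x)%g.

(** For a cocycle, the commutator pairing of the central extension of [T] that it defines. *)
Definition alternation (c : cochain2 k T) x y : k := uval (c x y) / uval (c y x).

Lemma alternation_skew c x y : alternation c x y * alternation c y x = 1.
Proof. by rewrite /alternation; field; rewrite !uval_neq0. Qed.

Lemma alternation_neq0 c x y : alternation c x y != 0.
Proof. by rewrite mulf_neq0 ?invr_eq0 ?uval_neq0. Qed.

(** The cocycle identity is used at [(x, y, z)], [(x, z, y)] and [(z, x, y)]. *)
Lemma alternation_mull c x y z : is_cocycle2 c -> alternation c (x * y)%g z =
  alternation c x z * alternation c y z.
Proof.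
move=> cc.
have ccv u v w : uval (c (u * v)%g w) = uval (c v w) * uval (c u (v * w)%g) / uval (c u v).
  by rewrite -val_unitsM cc val_unitsM mulfK ?uval_neq0.
have ccv' u v w : uval (c u (v * w)%g) = uval (c (u * v)%g w) * uval (c u v) / uval (c v w).
  by rewrite -val_unitsM -cc val_unitsM [X in X / _]mulrC mulfK ?uval_neq0.
rewrite /alternation ccv (TC y z) (ccv' x z y) (ccv' z x y) (TC z x).
by field; rewrite !uval_neq0.
Qed.

Lemma alternation_cobound f x y : alternation (cobound f) x y = 1.
Proof.
rewrite /alternation /cobound (TC y x) !(val_unitsM, val_unitsV).
by field; rewrite !uval_neq0.
Qed.

Lemma cocycle2_mulE (c d : cocycle2 k T) x y :
  cocycle2_val (c * d)%g x y = (cocycle2_val c x y * cocycle2_val d x y)%g.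
Proof. by []. Qed.

Lemma cocycle2_divE (c d : cocycle2 k T) x y :
  cocycle2_val (c^-1 * d)%g x y = ((cocycle2_val c x y)^-1 * cocycle2_val d x y)%g.
Proof. by []. Qed.

Lemma alternation_class (c d : cocycle2 k T) :
  to_quotg (coboundary2 k T) c = to_quotg (coboundary2 k T) d ->
  forall x y, alternation (cocycle2_val c) x y = alternation (cocycle2_val d) x y.
Proof.
move/to_quotgP/coboundary2P=> [f E] x y.
have := alternation_cobound f x y; rewrite -E /alternation !cocycle2_divE.
rewrite !(val_unitsM, val_unitsV) => E1; apply/esym/eqP;
  rewrite -subr_eq0 -[X in _ - X]mulr1 -E1.
by apply/eqP; field; rewrite !uval_neq0.
Qed.

End Alternation.

(** Equal alternations make the cocycle [c^-1 * d] symmetric, hence a coboundary. *)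
Lemma alternation_eq_class (k : closedFieldType) (T : finGroupType) (c d : cocycle2 k T) :
    (forall x y : T, (x * y = y * x)%g) ->
    (forall x y, alternation (cocycle2_val c) x y = alternation (cocycle2_val d) x y) ->
  to_quotg (coboundary2 k T) c = to_quotg (coboundary2 k T) d.
Proof.
move=> TC E; apply/to_quotgP/coboundary2P; apply: symmetric_cocycle_cobound => //.
  by have /cocycle2P := valP (c^-1 * d)%g.
move=> x y; rewrite !cocycle2_divE; apply: units_inj; rewrite !(val_unitsM, val_unitsV).
have /eqP := E x y; rewrite /alternation eqr_div ?uval_neq0 // => /eqP Exy.
apply: (mulfI (uval_neq0 (cocycle2_val c x y)));
  apply: (mulfI (uval_neq0 (cocycle2_val c y x))).
rewrite mulVKf ?uval_neq0 // [RHS]mulrCA mulVKf ?uval_neq0 //.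
by rewrite mulrC -Exy.
Qed.

(** * Square roots of bicharacters *)

Section SquareRoot.
Variables (k : closedFieldType) (gT : finGroupType) (A : {group gT}).
Hypothesis oddA : odd #|A|.
Local Notation Ah := (charg k A).

(* Squaring is invertible on the values of [b], with inverse [x |-> x ^+ m]. *)
Local Notation m := (#|A|.+1)./2.

Lemma bichar_expr b (bM : forall x y z : Ah, b (x * y)%g z = b x z * b y z :> k) x y :
  b x y != 0 -> (b x y ^+ m) ^+ 2 = b x y.
Proof.
move=> bxy0; have m2 : (m * 2)%N = #|A|.+1.
  by rewrite muln2 -[RHS]odd_double_half /= oddA.
rewrite -exprM m2 exprS; suff -> : b x y ^+ #|A| = 1 by rewrite mulr1.
have b1 : b 1%g y = 1.
  have b10 : b 1%g y != 0.
    by apply: contraNneq bxy0 => b10; rewrite -[x]mul1g bM b10 mul0r.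
  by apply: (mulfI b10); rewrite -bM !mulg1 mulr1.
have X j : b (x ^+ j)%g y = b x y ^+ j.
  by elim: j => [|j IH]; rewrite ?b1 ?expgS // bM IH exprS.
rewrite -X (_ : (x ^+ #|A|)%g = 1%g) //; apply: val_inj; apply/ffunP=> a.
rewrite [RHS]ffunE -(charg_expg_card x a).
by elim: #|A| => [|j IH]; rewrite ?ffunE // !expgS -IH ffunE.
Qed.

End SquareRoot.

(** * From invariant cohomology classes to lazy cohomology *)

Section MainTheorem.
Variables (k : closedFieldType) (hk : [pchar k] =i pred0).
Variables (G : finGroupType) (hodd : odd #|G|) (hInt : Int_k k G = Inn G).
Variables (A : {group G}) (abA : abelian A) (nA : (A <| [set: G])%g).
Hypothesis maxA : (forall B : {group G}, B <| [set: G] -> abelian B -> B \subset A)%g.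
Local Notation Ah := (charg k A).
Local Notation m := (#|A|.+1)./2.
Let AC (x y : Ah) : (x * y = y * x)%g := chargC x y.

Let oddA : odd #|A|.
Proof. by apply: dvdn_odd hodd; rewrite -cardsT cardSg ?subsetT. Qed.

(** The square root is taken as an [m]-th power rather than chosen, so it is multiplicative in [u]
    and in the characters, and compatible with the action of [G]. *)
Definition sqrt_alt (u : H2 k Ah) (x y : Ah) : k :=
  alternation (cocycle2_val (repr u)) x y ^+ m.

Let reprP (u : H2 k Ah) : is_cocycle2 (cocycle2_val (repr u)).
Proof. exact/cocycle2P/valP. Qed.

Lemma sqrt_alt_neq0 u x y : sqrt_alt u x y != 0.
Proof. by rewrite expf_neq0 ?alternation_neq0. Qed.

Lemma sqrt_alt_sqr u x y : sqrt_alt u x y ^+ 2 = alternation (cocycle2_val (repr u)) x y.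
Proof.
apply: bichar_expr => //; last exact: alternation_neq0.
by move=> x' y' z; apply: alternation_mull.
Qed.

Lemma sqrt_altV u x y : sqrt_alt u x y = (sqrt_alt u y x)^-1.
Proof.
by apply: (mulIf (sqrt_alt_neq0 u y x)); rewrite mulVf ?sqrt_alt_neq0 // -exprMn
  alternation_skew expr1n.
Qed.

Lemma sqrt_alt_mull u x y z : sqrt_alt u (x * y)%g z = sqrt_alt u x z * sqrt_alt u y z.
Proof. by rewrite /sqrt_alt alternation_mull // exprMn. Qed.

(** A bicharacter is a 2-cocycle; skewness carries multiplicativity over to the second argument. *)
Lemma sqrt_alt_cocycle u x y z :
  sqrt_alt u y z * sqrt_alt u x (y * z)%g = sqrt_alt u (x * y)%g z * sqrt_alt u x y.
Proof.
rewrite [sqrt_alt u x (y * z)%g]sqrt_altV !sqrt_alt_mull.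
rewrite [sqrt_alt u y x]sqrt_altV [sqrt_alt u z x]sqrt_altV.
by field; rewrite !sqrt_alt_neq0 oner_neq0.
Qed.

Lemma sqrt_alt_class (c : cocycle2 k Ah) x y :
  sqrt_alt (to_quotg _ c) x y = alternation (cocycle2_val c) x y ^+ m.
Proof. by congr (_ ^+ _); apply: alternation_class => //; apply: to_quotg_repr. Qed.

Lemma sqrt_altM u v x y : sqrt_alt (u * v)%g x y = sqrt_alt u x y * sqrt_alt v x y.
Proof.
rewrite -{1}(to_quotg_repr u) -{1}(to_quotg_repr v) -to_quotgM sqrt_alt_class -exprMn.
by congr (_ ^+ _); rewrite /alternation !cocycle2_mulE !val_unitsM; field; rewrite !uval_neq0.
Qed.

(** Only the class of the cocycle is invariant, but the alternation depends on nothing more than the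
    class, so it is invariant as a function. *)
Lemma sqrt_alt_conj (u : H2_inv k nA) g x y :
  sqrt_alt (H2_inv_val u) (charg_conj nA g x) (charg_conj nA g y) =
  sqrt_alt (H2_inv_val u) x y.
Proof.
have /H2_invP/(_ (g^-1)%g) := valP u; rewrite /H2_act invgK => E.
by rewrite -{2}E /H2_pull sqrt_alt_class.
Qed.

Lemma itwist_of_class (u : H2_inv k nA) :
  {F : itwist k G | uval F = char_twist (sqrt_alt (H2_inv_val u))}.
Proof.
set c := sqrt_alt _.
have tc : is_twist (char_twist c).
  by apply: (char_twist_is_twist hk abA) => *; rewrite /c ?sqrt_alt_neq0 ?sqrt_alt_cocycle.
have P : Units (proj1 tc) \in @itwist_pred k G.
  apply/itwistP; split => //=; apply/(char_twist_invariantP hk abA nA) => g x y.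
  exact: sqrt_alt_conj.
by exists (ITwist P).
Qed.

Definition lazy_class (u : H2_inv k nA) : H2lazy k G :=
  to_quotg _ (sval (itwist_of_class u)).

Lemma lazy_classM : {morph lazy_class : u v / (u * v)%g}.
Proof.
move=> u v; rewrite /lazy_class -to_quotgM; congr to_quotg; apply: itwist_inj.
rewrite uval_itwistM; do 3!case: (itwist_of_class _) => ? /= ->.
rewrite (char_twist_mul hk abA); apply: (eq_on_char_idem2 hk abA) => x y.
by rewrite !(char_twist_idem2 hk) sqrt_altM.
Qed.

(** The image of [delta1] consists of symmetric elements, whereas [q], a ratio of skew functions, is
    skew. So [q] squares to 1, and the alternations, being the squares, agree. *)
Lemma lazy_class_inj : injective lazy_class.
Proof.
move=> u v /to_quotgP/delta1_imageP[a E].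
pose q x y := sqrt_alt (H2_inv_val v) x y / sqrt_alt (H2_inv_val u) x y.
have Dq : uval (delta1 a) = char_twist q.
  have /(congr1 (fun F : itwist k G => uval F)) :
      sval (itwist_of_class v) = (sval (itwist_of_class u) * delta1 a)%g.
    by rewrite -E mulKVg.
  rewrite uval_itwistM (svalP (itwist_of_class u)) (svalP (itwist_of_class v)) => Ev.
  have uu : char_twist (sqrt_alt (H2_inv_val u)) \is a GRing.unit.
    by apply: (char_twist_unit hk abA) => *; apply: sqrt_alt_neq0.
  apply: (mulrI uu); rewrite -Ev (char_twist_mul hk abA);
    apply: (eq_on_char_idem2 hk abA) => x y.
  by rewrite !(char_twist_idem2 hk) /q mulrC divfK ?sqrt_alt_neq0.
have symq x y : q x y = q y x.
  have symD : flip (char_twist q) = char_twist q.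
    by rewrite -Dq uval_delta1 flipM flip_tens flip_coprod.
  apply: (char_twist_inj hk (c := q) (d := fun x y => q y x)).
  by rewrite -[LHS]symD flip_char_twist.
apply: val_inj; rewrite -[LHS]to_quotg_repr -[RHS]to_quotg_repr.
apply: alternation_eq_class => // x y; rewrite -!sqrt_alt_sqr.
have := symq x y.
rewrite /q [sqrt_alt _ y x]sqrt_altV [sqrt_alt (H2_inv_val u) y x]sqrt_altV invrK.
rewrite [RHS]mulrC => /eqP; rewrite eqr_div ?sqrt_alt_neq0 // => /eqP Evu.
by rewrite !expr2 Evu.
Qed.

Lemma lazy_class_surj w : exists u, lazy_class u = w.
Proof.
set F := repr w; have /itwistP[tF iF] := valP F.
have [b Rb [bM bV]] := rmat_bicharacter hk abA tF iF maxA.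
have b0 x y : b x y != 0.
  by apply: contraTneq (oner_neq0 k) => b0; rewrite -(bV x y) b0 mul0r eqxx.
have bMr x y z : b x (y * z)%g = b x y * b x z.
  have bVE x' y' : b x' y' = (b y' x')^-1.
    by apply: (mulIf (b0 y' x')); rewrite bV mulVf.
  by rewrite bVE bM invfM -!bVE.
have bJ g x y : b (charg_conj nA g x) (charg_conj nA g y) = b x y.
  apply: (proj1 (char_twist_invariantP hk abA nA b)); rewrite -Rb; exact: rmat_invariant.
(* The arguments are exchanged because [b] is the transform of [F_21 F^-1]: the ratio
   [c y x / c x y] has to be [b x y]. *)
pose c x y := b y x ^+ m.
have c_sqr x y : c x y ^+ 2 = b y x by apply: bichar_expr.
have c0 x y : c x y \is a GRing.unit by rewrite unitfE expf_neq0.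
have cV x y : c y x = (c x y)^-1.
  have ucxy : c x y != 0 by rewrite -unitfE.
  by apply: (mulIf ucxy); rewrite mulVf // -exprMn bV expr1n.
pose C : cochain2 k Ah := fun x y => Units (c0 x y).
have CP : C \in @cocycle2_pred k Ah.
  apply/cocycle2P=> x y z; apply: units_inj; rewrite !val_unitsM /= /c bM bMr !exprMn.
  by ring.
pose C2 : cocycle2 k Ah := Cocycle2 CP.
have Cinv : to_quotg (coboundary2 k Ah) C2 \in H2_inv_pred nA.
  apply/H2_invP=> g; rewrite /H2_act H2_pullE; congr to_quotg; apply: val_inj => /=.
  apply: funext => x; apply: funext => y; apply: units_inj; rewrite /= /c bJ.
  by [].
pose u := H2Inv Cinv; exists u.
(* As [c] is skew, its alternation is its square, whose [m]-th power is [c] again. *)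
have sqc x y : sqrt_alt (H2_inv_val u) x y = c x y.
  by rewrite sqrt_alt_class /alternation /= (cV x y) invrK -expr2 c_sqr.
pose Fu := sval (itwist_of_class u).
have FuE : uval Fu = char_twist c.
  rewrite (svalP (itwist_of_class u)); apply: (eq_on_char_idem2 hk abA) => x y.
  by rewrite !(char_twist_idem2 hk) sqc.
rewrite -(to_quotg_repr w) -/F; apply/to_quotgP/delta1_imageP.
(* The twists [Fu] and [F] have the same R-matrix, so the quotient [F'] is symmetric. *)
apply: symmetric_itwist_delta1 => //; set F' := (_ * _)%g.
have FF : uval Fu * uval F' = uval F by rewrite -uval_itwistM mulKVg.
have uct : flip (char_twist c) \is a GRing.unit.
  by apply: flip_unit; rewrite -FuE; apply: units_valP.
apply: (mulrI uct); rewrite -{1}FuE -flipM FF.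
have -> : flip (uval F) = char_twist b * uval F.
  by rewrite -Rb /rmat divrK //; case: tF.
rewrite -FF FuE mulrA (char_twist_mul hk abA) flip_char_twist; congr (_ * _);
  apply: (eq_on_char_idem2 hk abA) => x y.
by rewrite !(char_twist_idem2 hk) (cV x y) -(c_sqr y x) (cV x y) expr2 -mulrA mulVf ?mulr1 //
  -unitfE.
Qed.
End MainTheorem.

Theorem corollary4p14 (k : closedFieldType) (hk : [pchar k] =i pred0)
    (G : finGroupType) (hodd : odd #|G|) (hInt : Int_k k G = Inn G)
    (A : {group G}) (hA : unique_max_abelian_normal A) :
  exists f : {multiplicative H2lazy k G ->
                H2_inv k (unique_max_abelian_normal_normal hA)},
    bijective f.
Proof.
set nA := unique_max_abelian_normal_normal hA.
have [/maxgroupp/andP[_ abA] maxA] := hA.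
have maxA' (B : {group G}) : (B <| [set: G] -> abelian B -> B \subset A)%g.
  move=> nB abB; have [|C maxC sBC] := @maxgroup_exists _ (fun C : {group G} =>
    (C <| [set: G])%g && abelian C) B.
    by rewrite nB.
  by rewrite -(maxA C maxC).
pose f := lazy_class hk abA (nA := nA).
have fM : {morph f : u v / (u * v)%g} := lazy_classM hk abA (nA := nA).
have f_inj : injective f by exact: lazy_class_inj hodd _ _ _.
(* [lazy_class] maps invariant classes to lazy ones; the isomorphism asked for is its inverse
   [g]. *)
have [g gK0] := choice (lazy_class_surj hk hodd hInt abA nA maxA'); have gK : cancel g f := gK0.
have fK : cancel f g by move=> u; apply: f_inj; rewrite gK.
have gM : {morph g : u v / (u * v)%g}.
  by move=> u v; apply: f_inj; rewrite fM !gK.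
pose gm := isMultiplicative.Build _ _ g gM.
exists (HB.pack_for {multiplicative H2lazy k G -> H2_inv k nA} g gm).
by exists f.
Qed.
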